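(* Let $\Gamma$ be a locally arc-wise connected topological space and let $\mathcal F$ be a finite family of open subsets of $\Gamma$ that is acyclic with slack $s$. Then for every non-negative integer $\ell\ge s$, $\tilde H_\ell(\mathcal M(\mathcal F);\mathbb Q)\cong\tilde H_\ell(\bigcup_{U\in\mathcal F}U;\mathbb Q)$.
   Context: Homology is over $\mathbb Q$, $\tilde H$ is reduced homology. $\mathcal F$ is acyclic with slack $s$ if for every non-empty $\mathcal G\subseteq\mathcal F$ and every $i\ge\max(1,s-|\mathcal G|)$, $\tilde H_i(\bigcap_{U\in\mathcal G}U;\mathbb Q)=0$. The multinerve $\mathcal M(\mathcal F)$ is the set of pairs $(C,A)$ with $A\subseteq\mathcal F$ and $C$ a connected component of $\bigcap_{U\in A}U$, where by convention $\bigcap_{U\in\emptyset}U=\bigcup_{U\in\mathcal F}U$; it is partially ordered by $(C',A')\preceq(C,A)$ iff $C\supseteq C'$ and $A\subseteq A'$. It is a simplicial poset: it has least element $(\bigcup\mathcal F,\emptyset)$ and each lower interval below $(C,A)$ is isomorphic to the Boolean lattice $2^A$; the dimension of $(C,A)$ is $|A|-1$. Its homology is that of its geometric realization (obtained by gluing one geometric $(|A|-1)$-simplex for each $(C,A)$ along its faces), equivalently the homology of the chain complex whose degree-$n$ part is the $\mathbb Q$-vector space with basis $\{(C,A)\in\mathcal M(\mathcal F):|A|=n+1\}$ and, after fixing a total order on $\mathcal F$ and writing $A=\{X_0<\dots<X_n\}$, with differential $d(C,A)=\sum_{i=0}^n(-1)^i(C_i,A\setminus\{X_i\})$, where $C_i$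 is the connected component of $\bigcap_{U\in A\setminus\{X_i\}}U$ containing $C$. *)

(* Defs.v *)
From HB Require Import structures.
From mathcomp Require Import all_boot all_order all_algebra finmap.
From mathcomp Require Import generic_quotient ring_quotient.
From mathcomp Require Import all_classical all_reals.
From mathcomp Require Import topology normedtype.
From mathcomp Require Import freeg zify.

Set Implicit Arguments.
Unset Strict Implicit.
Unset Printing Implicit Defensive.

Import Order.TTheory GRing.Theory Num.Theory.
Import numFieldNormedType.Exports.

Local Open Scope classical_set_scope.
Local Open Scope ring_scope.

(* homology f g is ker g / im f for A --f--> B --g--> C.  It is only used for
   composable differentials, where g \o f = 0; boundary_pred is im f viewed
   inside ker g. *)
Section LinearHomology.
Variables (A B C : lmodType rat) (f : {linear A -> B}) (g : {linear B -> C}).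

Definition cycle_pred : {pred B} := [pred b | g b == 0].

Lemma cycle_pred_closed : submod_closed cycle_pred.
Proof.
split=> [|a u v]; rewrite !inE ?linear0 // => /eqP gu /eqP gv.
by rewrite linearP gu gv scaler0 addr0.
Qed.
HB.instance Definition _ :=
  GRing.isSubmodClosed.Build rat B cycle_pred cycle_pred_closed.

Record cycles := Cycle { cycle_val :> B; _ : cycle_val \in cycle_pred }.
HB.instance Definition _ := [isSub for cycle_val].
HB.instance Definition _ := [Choice of cycles by <:].
HB.instance Definition _ := [SubChoice_isSubLmodule of cycles by <:].

Definition boundary_pred : {pred cycles} :=
  [pred z : cycles | `[< exists a, f a = cycle_val z >]].

Lemma boundary_predP (z : cycles) :
  reflect (exists a, f a = cycle_val z) (z \in boundary_pred).
Proof. exact: asboolP. Qed.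

Lemma boundary_pred_closed : submod_closed boundary_pred.
Proof.
split=> [|k u v]; first by apply/boundary_predP; exists 0; rewrite linear0.
move=> /boundary_predP[a fa] /boundary_predP[b fb]; apply/boundary_predP.
by exists (k *: a + b); rewrite linearP fa fb.
Qed.
HB.instance Definition _ :=
  GRing.isSubmodClosed.Build rat cycles boundary_pred boundary_pred_closed.

Definition homology : Type := Quotient.quot boundary_pred.
HB.instance Definition _ := Choice.on homology.
HB.instance Definition _ := GRing.Zmodule.on homology.

Definition homology_class (z : cycles) : homology :=
  (\pi_(Quotient.quot boundary_pred) z)%qT.

Lemma homology_classD z z' :
  homology_class (z + z') = homology_class z + homology_class z'.
Proof. exact: (@Quotient.pi_add _ boundary_pred). Qed.

Lemma homology_classP z z' :
  homology_class z = homology_class z' <-> z - z' \in boundary_pred.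
Proof.
rewrite Quotient.idealrBE; split=> [h|/eqP//]; exact/eqP.
Qed.

Lemma homology_reprK (x : homology) : homology_class (repr x) = x.
Proof. exact: reprK. Qed.

Definition homology_scale (k : rat) (x : homology) : homology :=
  homology_class (k *: repr x).

Lemma homology_scaleE k z :
  homology_scale k (homology_class z) = homology_class (k *: z).
Proof.
apply/homology_classP; rewrite -scalerBr rpredZ //.
by apply/homology_classP; rewrite homology_reprK.
Qed.

Lemma homology_scaleA a b x :
  homology_scale a (homology_scale b x) = homology_scale (a * b) x.
Proof. by rewrite -(homology_reprK x) !homology_scaleE scalerA. Qed.

Lemma homology_scale1 : left_id 1 homology_scale.
Proof. by move=> x; rewrite -(homology_reprK x) homology_scaleE scale1r. Qed.

Lemma homology_scaleDr : right_distributive homology_scale +%R.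
Proof.
move=> a x y; rewrite -(homology_reprK x) -(homology_reprK y).
by rewrite -homology_classD !homology_scaleE scalerDr homology_classD.
Qed.

Lemma homology_scaleDl x : {morph homology_scale^~ x : a b / a + b}.
Proof.
move=> a b; rewrite -(homology_reprK x) !homology_scaleE scalerDl.
by rewrite homology_classD.
Qed.

HB.instance Definition _ := GRing.Zmodule_isLmodule.Build rat homology
  homology_scaleA homology_scale1 homology_scaleDr homology_scaleDl.

End LinearHomology.

Section LinearLift.
Variables (S : nzRingType) (K : choiceType) (V : lmodType S) (h : K -> V).

Definition linear_lift : {freeg K / S} -> V := fglift h.

Lemma linear_lift_is_zmod_morphism : zmod_morphism linear_lift.
Proof. exact: lift_is_additive. Qed.
HB.instance Definition _ := GRing.isZmodMorphism.Build
  {freeg K / S} V linear_lift linear_lift_is_zmod_morphism.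

Lemma linear_lift_is_scalable : scalable linear_lift.
Proof.
move=> k D; pose c x := coeff x D; pose r := dom D.
have -> : D = \sum_(x <- r) << c x *g x >> by rewrite freeg_sumE.
rewrite scaler_sumr 2!raddf_sum scaler_sumr; apply: eq_bigr => x _ /=.
have -> : k *: << c x *g x >> = << k * c x *g x >> :> {freeg K / S}.
  by apply/eqP/freeg_eqP => y; rewrite coeffZ !coeffU mulrA.
by rewrite /linear_lift !liftU scalerA.
Qed.
HB.instance Definition _ := GRing.isScalable.Build
  S {freeg K / S} V *:%R linear_lift linear_lift_is_scalable.

End LinearLift.

(* face i forgets the i-th vertex; faceC is the simplicial identity
   d_i d_(j+1) = d_j d_i for i <= j, which makes boundary below square to 0. *)
Record semisimplicial_set := SemisimplicialSet {
  simplices :> nat -> choiceType;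
  face : forall n, 'I_n.+2 -> simplices n.+1 -> simplices n;
  faceC : forall n (i j : 'I_n.+2) (x : simplices n.+2), (i <= j)%N ->
    face i (face (fintype.lift ord0 j) x) = face j (face (widen_ord (leqnSn _) i) x)
}.

Section ReducedHomology.
Variable X : semisimplicial_set.

Definition chains (n : nat) : lmodType rat := {freeg (X n) / rat}.

Definition boundary (n : nat) : {linear chains n.+1 -> chains n} :=
  linear_lift (fun x : X n.+1 =>
    \sum_(i < n.+2) (-1) ^+ i *: (<< face i x >> : chains n)).

(* The degree -1 part of the augmented complex, spanned by the empty simplex. *)
Definition augmentation : {linear chains 0 -> rat^o} :=
  linear_lift (fun=> 1 : rat^o).

Definition reduced_homology (n : nat) : lmodType rat :=
  if n is m.+1 then homology (boundary m.+1) (boundary m)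
  else homology (boundary 0) augmentation.

End ReducedHomology.

Section SingularHomology.
Variable R : realType.

Definition std_simplex (n : nat) : set 'rV[R]_n.+1 :=
  [set x | (forall i, 0 <= x 0 i) /\ \sum_i x 0 i = 1].
Arguments std_simplex : clear implicits.

Definition coface_fun n (i : 'I_n.+2) (x : 'rV[R]_n.+1) : 'rV[R]_n.+2 :=
  \row_j (if unlift i j is Some k then x 0 k else 0).

Lemma coface_subproof n (i : 'I_n.+2) (x : std_simplex n) :
  coface_fun i (set_val x) \in std_simplex n.+1.
Proof.
have /= [x0 x1] := set_valP x; rewrite inE; split=> [j|].
  by rewrite mxE; case: unliftP.
rewrite (bigD1 i) //= mxE unlift_none add0r -{}x1.
rewrite (reindex_onto (fintype.lift i) (fun j => odflt ord0 (unlift i j))) /=.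
  apply: eq_big => k; first by rewrite liftK eqxx eq_sym neq_lift.
  by rewrite mxE liftK.
by move=> j; case: unliftP => [k ->//|->]; rewrite eqxx.
Qed.

Definition coface n (i : 'I_n.+2) (x : std_simplex n) : std_simplex n.+1 :=
  exist _ (coface_fun i (set_val x)) (coface_subproof i x).

Lemma coface_fun_continuous n (i : 'I_n.+2) : continuous (coface_fun i).
Proof.
move=> x U [P nP sPU].
suff: \forall y \near x, forall k j, P k j (coface_fun i y k j).
  by apply: filterS => y Py; exact: sPU.
have FF : Filter (nbhs x) := nbhs_filter x.
apply: (filter_forall FF) => k; apply: (filter_forall FF) => j.
have := nP k j; rewrite /coface_fun mxE => Pj.
suff: nbhs x (fun y : 'rV[R]_n.+1 => P k j
    (if unlift i j is Some l then y 0 l else 0)).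
  by apply: filterS => y; rewrite mxE.
case: unliftP Pj => [l _|_] Pj; first exact: coord_continuous Pj.
by apply: (filterS _ (@filterT _ (nbhs x) FF)) => y _; exact: nbhs_singleton Pj.
Qed.

Lemma coface_continuous n (i : 'I_n.+2) : continuous (coface i).
Proof.
apply: continuous_comp_initial.
have -> : set_val \o coface i = coface_fun i \o set_val by [].
move=> x; apply: continuous_comp; first exact: initial_continuous.
exact: coface_fun_continuous.
Qed.
HB.instance Definition _ n (i : 'I_n.+2) :=
  isContinuous.Build _ _ (coface i) (@coface_continuous n i).

Lemma coface_funC n (i j : 'I_n.+2) (x : 'rV[R]_n.+1) : (i <= j)%N ->
  coface_fun (fintype.lift ord0 j) (coface_fun i x) =
  coface_fun (widen_ord (leqnSn _) i) (coface_fun j x).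
Proof.
move=> ij; set j1 := fintype.lift _ _; set i0 := widen_ord _ _.
have liftC m : fintype.lift j1 (fintype.lift i m) =
               fintype.lift i0 (fintype.lift j m).
  by apply: val_inj; rewrite /= /bump /=; lia.
apply/rowP => k; rewrite !mxE.
case: unliftP => [l ->|->]; first rewrite mxE; last first.
  have -> : j1 = fintype.lift i0 j.
    by apply: val_inj; rewrite /= /bump /= ij.
  by rewrite liftK mxE unlift_none.
case: unliftP => [m ->|->]; first by rewrite liftC liftK mxE liftK.
have -> : fintype.lift j1 i = i0.
  by apply: val_inj; rewrite /= /bump /= add1n ltnNge ij.
by rewrite unlift_none.
Qed.

Section Singular.
Variable T : topologicalType.

Definition singular_simplex (n : nat) : choiceType :=
  continuousType (std_simplex n) T.

Definition singular_face n (i : 'I_n.+2) (s : singular_simplex n.+1) :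
  singular_simplex n := s \o coface i.

Lemma singular_faceC n (i j : 'I_n.+2) (s : singular_simplex n.+2) :
  (i <= j)%N ->
  singular_face i (singular_face (fintype.lift ord0 j) s) =
  singular_face j (singular_face (widen_ord (leqnSn _) i) s).
Proof.
move=> ij; apply/continuousEP => x /=; congr (s _).
exact/val_inj/coface_funC.
Qed.

Definition singular_set : semisimplicial_set :=
  SemisimplicialSet singular_faceC.

End Singular.

Definition reduced_singular_homology (T : topologicalType) (n : nat) : lmodType rat :=
  reduced_homology (singular_set T) n.

End SingularHomology.

Section LocallyPathConnected.
Variables (R : realType) (T : topologicalType).

Definition path_connected (W : set T) : Prop :=
  forall x y, W x -> W y -> exists g : R -> T,
    [/\ {within `[0, 1], continuous g}, g 0 = x, g 1 = y &
        g @` `[0, 1] `<=` W].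

(* "Arc-wise connected" in the sense of joining points by continuous paths. *)
Definition locally_path_connected : Prop :=
  forall (x : T) (V : set T), nbhs x V ->
    exists W, [/\ open W, W x, W `<=` V & path_connected W].

End LocallyPathConnected.

Section Multinerve.
Variables (T : topologicalType) (F : {fset set T}).
Implicit Types (A : {set F}) (C S : set T).

Definition family_union : set T := \bigcup_(U in [set` F]) U.

Definition family_inter A : set T := \bigcap_(U in [set` A]) val U.

Definition is_component S C : Prop :=
  exists2 x, S x & C = connected_component S x.

(* The empty intersection is the union of the family; the multinerve has a
   single element over the empty set of indices, its least element, even when
   the union is not connected. *)
Definition multinerve : set (set T * {set F}) :=
  [set p | if p.2 == finset.set0 then p.1 = family_union
           else is_component (family_inter p.2) p.1].

(* The component of S containing C, for C a nonempty connected subset of S. *)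
Definition component_containing S C : set T :=
  \bigcup_(x in C) connected_component S x.

Definition multinerve_simplex (n : nat) : choiceType :=
  {p : set T * {set F} | `[< multinerve p >] && (#|p.2| == n.+1)}.

Lemma multinerve_simplex_card n (p : multinerve_simplex n) :
  #|(val p).2| = n.+1.
Proof. by case: p => p /= /andP[_ /eqP]. Qed.

(* The total order on F is the one in which the finite type F is enumerated, so
   that enum_val lists the elements of a subset of F in increasing order. *)
Definition multinerve_vertex n (i : 'I_n.+1) (p : multinerve_simplex n) : F :=
  enum_val (cast_ord (esym (multinerve_simplex_card p)) i).

Definition multinerve_face_val n (i : 'I_n.+2) (p : multinerve_simplex n.+1) :
    set T * {set F} :=
  let A' := ((val p).2 :\ multinerve_vertex i p)%SET in
  (component_containing (family_inter A') (val p).1, A').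

Lemma component_containingE S S' x : S x -> S `<=` S' ->
  component_containing S' (connected_component S x) = connected_component S' x.
Proof.
move=> Sx SS'; apply/seteqP; split=> [y [z Sxz S'zy]|y S'xy].
  apply: connected_component_trans S'zy.
  case: Sxz => B [Bx BS cB] Bz; exists B => //; split=> //.
  exact: subset_trans SS'.
by exists x => //; exact: connected_component_refl.
Qed.

Lemma multinerve_simplex_component n (p : multinerve_simplex n) :
  is_component (family_inter (val p).2) (val p).1.
Proof.
case: p => -[C A] /= /andP[/asboolP + /eqP cA]; rewrite /multinerve /=.
by rewrite -cards_eq0 cA.
Qed.

Lemma family_interS A A' : A' \subset A -> family_inter A `<=` family_inter A'.
Proof. by move=> /fintype.subsetP sA x Ax U /= /sA; exact: Ax. Qed.

Lemma multinerve_face_subproof n (i : 'I_n.+2) (p : multinerve_simplex n.+1) :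
  `[< multinerve (multinerve_face_val i p) >] &&
  (#|(multinerve_face_val i p).2| == n.+1).
Proof.
have cA' : #|(multinerve_face_val i p).2| = n.+1.
  have := multinerve_simplex_card p.
  by rewrite (cardsD1 (multinerve_vertex i p)) enum_valP => -[].
rewrite cA' eqxx andbT; apply/asboolP; rewrite /multinerve /=.
rewrite -cards_eq0 cA' /=.
have [x Ax ->] := multinerve_simplex_component p; exists x.
  exact: family_interS (subD1set _ _) _ Ax.
by apply: component_containingE => //; exact/family_interS/subD1set.
Qed.

Definition multinerve_face n (i : 'I_n.+2) (p : multinerve_simplex n.+1) :
  multinerve_simplex n :=
  exist _ (multinerve_face_val i p) (multinerve_face_subproof i p).

Lemma nth_enum_setD1 A x0 k i : (k < #|A|)%N ->
  nth x0 (enum (A :\ nth x0 (enum A) k)%SET) i = nth x0 (enum A) (bump k i).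
Proof.
rewrite cardE => kA; set y := nth x0 (enum A) k.
have -> : enum (A :\ y)%SET = rem y (enum A).
  rewrite rem_filter ?enum_uniq // /enum_mem -filter_predI.
  by apply: eq_filter => z; rewrite /= !inE.
rewrite remE index_uniq ?enum_uniq // nth_cat size_take kA /bump.
case: ltnP => ki; first by rewrite nth_take.
by rewrite nth_drop; congr nth; rewrite addSn subnKC.
Qed.

Lemma multinerve_faceC n (i j : 'I_n.+2) (p : multinerve_simplex n.+2) :
  (i <= j)%N ->
  multinerve_face i (multinerve_face (fintype.lift ord0 j) p) =
  multinerve_face j (multinerve_face (widen_ord (leqnSn _) i) p).
Proof.
move=> ij; apply: val_inj => /=; rewrite /multinerve_face_val /=.
set A := (val p).2; have cA := multinerve_simplex_card p.
pose x0 : F := multinerve_vertex ord0 p.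
pose v k := nth x0 (enum A) k.
have vE (k : 'I_n.+3) : multinerve_vertex k p = v k.
  by rewrite /multinerve_vertex (enum_val_nth x0).
have v2 (k : 'I_n.+3) (l : 'I_n.+2) :
    multinerve_vertex l (multinerve_face k p) = v (bump k l).
  rewrite /multinerve_vertex (enum_val_nth x0) /= vE nth_enum_setD1 //.
  by rewrite cA.
rewrite !v2 !vE /= /bump /= !add1n ltnNge ij /= add0n.
have -> : (A :\ v j.+1 :\ v i = A :\ v i :\ v j.+1)%SET.
  by rewrite !finset.setDDl [in LHS]finset.setUC.
congr pair; set A2 := (A :\ v i :\ v j.+1)%SET.
have [x Ax ->] := multinerve_simplex_component p.
have sA k : family_inter A `<=` family_inter (A :\ v k)%SET.
  exact/family_interS/subD1set.
rewrite !component_containingE //; do ?exact: sA.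
- exact/family_interS/subD1set.
- rewrite /A2 finset.setDDl finset.setUC -finset.setDDl.
  exact/family_interS/subD1set.
Qed.

Definition multinerve_set : semisimplicial_set :=
  SemisimplicialSet multinerve_faceC.

Definition reduced_multinerve_homology (n : nat) : lmodType rat :=
  reduced_homology multinerve_set n.

End Multinerve.

(* G ranges over the subsets of the finite set F.  Slacks are integers and the
   subtraction is not truncated. *)
Definition acyclic_with_slack (R : realType) (T : topologicalType)
    (F : {fset set T}) (s : int) : Prop :=
  forall (G : {set F}), G != finset.set0 ->
  forall i : nat, Num.max 1 (s - #|G|%:Z) <= i%:Z ->
  forall x : reduced_singular_homology R (family_inter G) i, x = 0.

Definition lmod_isomorphic (V W : lmodType rat) : Prop :=
  exists f : {linear V -> W}, bijective f.

(* Main.v *)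
(** Consider the double complex whose term (p, q) is spanned by the pairs of a
    singular q-simplex sigma of Gamma and a set A of p + 1 members of F whose
    intersection contains sigma.  It is augmented by the singular chains carried
    by a single member of F (p = -1) and by the chains of the multinerve
    (q = -1, a point being sent to its connected component).

    The rows are exact, by coning with a member of F containing sigma.  In column
    p the homology in degree q is the sum of the reduced groups H_q of the
    (p + 1)-fold intersections, except that exactness in degrees 0 and -1 only
    uses that the components of an open subset of Gamma are joined by paths.  With
    slack s these groups vanish as soon as p + q >= s - 1, so zigzags through
    total degrees l - 1 and l identify the homologies of the two augmentations in
    degree l >= s.  Finally, barycentric subdivision shows that chains carried by
    members of F compute the singular homology of the union. *)

Require Import Defs.
From HB Require Import structures.
From mathcomp Require Import all_boot all_order all_algebra finmap.
From mathcomp Require Import all_classical all_reals.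
From mathcomp Require Import topology normedtype.
From mathcomp Require Import generic_quotient ring_quotient sequences.
From mathcomp Require Import freeg zify.

Set Implicit Arguments.
Unset Strict Implicit.
Unset Printing Implicit Defensive.

Import Order.TTheory GRing.Theory Num.Theory.
Import numFieldNormedType.Exports.

Local Open Scope classical_set_scope.
Local Open Scope ring_scope.

(** * Chains and supports *)

(** Below the slack the columns give no information, so no comparison of whole complexes is at hand
    and the argument stays on two neighbouring antidiagonals. A zigzag depends on choices; it is
    therefore treated as a linear relation between chains of the multinerve and singular chains, and
    the isomorphism is extracted from that relation. Finding a partner for every cycle uses
    exactness for degree [l], matching boundaries with boundaries uses it for [l.+1]. The rows are
    exact everywhere, so only the columns see the bound [s <= l]. Subcomplexes are support
    conditions on chains of one free module, not modules over subtypes. The module at a place (p, q)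
    then does not depend on p, only the condition does, and passing to an intersection or from small
    to arbitrary simplices changes no type. *)

Definition submodule (V : lmodType rat) (P : V -> Prop) : Prop :=
  P 0 /\ forall a u v, P u -> P v -> P (a *: u + v).

Section Submodule.
Variables (V : lmodType rat) (P : V -> Prop).
Hypothesis subP : submodule P.

Lemma submodule0 : P 0. Proof. by case: subP. Qed.

Lemma submoduleD u v : P u -> P v -> P (u + v).
Proof. by case: subP => _ h Pu Pv; rewrite -[u]scale1r; exact: h. Qed.

Lemma submoduleZ a u : P u -> P (a *: u).
Proof. by case: subP => P0 h Pu; rewrite -[_ *: _]addr0; exact: h. Qed.

Lemma submoduleB u v : P u -> P v -> P (u - v).
Proof.
by move=> Pu Pv; rewrite -scaleN1r; apply: submoduleD => //; exact: submoduleZ.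
Qed.

Lemma submodule_sum (I : Type) (r : seq I) (Q : pred I) (G : I -> V) :
  (forall i, Q i -> P (G i)) -> P (\sum_(i <- r | Q i) G i).
Proof. by move=> PG; apply: big_ind => //; [exact: submodule0|exact: submoduleD]. Qed.

End Submodule.

Lemma submodule_eq (V W : lmodType rat) (f g : {linear V -> W}) :
  submodule (fun v => f v = g v).
Proof. by split=> [|a u v fu fv]; rewrite ?linear0 // !linearP fu fv. Qed.

Lemma submodule_preim (V W : lmodType rat) (f : {linear V -> W}) (P : W -> Prop) :
  submodule P -> submodule (fun v => P (f v)).
Proof.
move=> [P0 PL]; split=> [|a u v fu fv]; rewrite ?linear0 // linearP; exact: PL.
Qed.

Lemma submodule_exists (A B C : lmodType rat) (f : {linear A -> B}) (g : {linear C -> B})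
    (P : A -> Prop) :
  submodule P -> submodule (fun c => exists2 b, P b & f b = g c).
Proof.
move=> subP; split=> [|a u v [b Pb bu] [b' Pb' bv]].
  by exists 0; rewrite ?linear0 //; exact: submodule0.
by exists (a *: b + b'); [case: subP => _; exact|rewrite !linearP bu bv].
Qed.

Definition chain (K : choiceType) : lmodType rat := {freeg K / rat}.

Definition gen (K : choiceType) (x : K) : chain K := << x >>.

Definition lin (K : choiceType) (V : lmodType rat) (h : K -> V) :
  {linear chain K -> V} := linear_lift h.

Section Support.
Variable K : choiceType.
Implicit Types (Q : K -> Prop) (c : chain K).

Definition supported Q c : Prop := forall x, x \in dom (c : {freeg K / rat}) -> Q x.

Lemma supported_submodule Q : submodule (supported Q).
Proof.
split=> [x|a u v Qu Qv x]; first by rewrite dom0.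
by move/domD_subset; rewrite mem_cat => /orP[/domZ_subset/Qu|/Qv].
Qed.

Lemma supportedU Q x : Q x -> supported Q (gen x).
Proof. by move=> Qx y; rewrite domU1 inE => /eqP->. Qed.

Lemma chainE c :
  c = \sum_(x <- dom (c : {freeg K / rat})) coeff x (c : {freeg K / rat}) *: gen x.
Proof.
rewrite -[LHS]freeg_sumE; apply: eq_bigr => x _.
by apply/eqP/freeg_eqP => y; rewrite coeffZ !coeffU mul1r.
Qed.

(** The workhorse for checks on generators: equalities of linear maps, preimages and existence
    statements are all submodules, so one induction serves them. *)
Lemma supported_ind Q (P : chain K -> Prop) c : submodule P ->
  (forall x, Q x -> P (gen x)) -> supported Q c -> P c.
Proof.
move=> subP PU Qc; rewrite [c]chainE big_seq_cond.
by apply: submodule_sum => // x /andP[/Qc Qx _]; exact/(submoduleZ subP)/PU.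
Qed.

Lemma supported_eq Q (V : lmodType rat) (f g : {linear chain K -> V}) c :
  (forall x, Q x -> f (gen x) = g (gen x)) -> supported Q c -> f c = g c.
Proof.
move=> fg; apply: (@supported_ind Q (fun c => f c = g c)) => //.
exact: submodule_eq.
Qed.

Lemma chain_linear_eq (V : lmodType rat) (f g : {linear chain K -> V}) :
  (forall x, f (gen x) = g (gen x)) -> f =1 g.
Proof. by move=> fg c; apply: (@supported_eq (fun=> True)). Qed.

Lemma supported_sub Q Q' c : (forall x, Q x -> Q' x) -> supported Q c -> supported Q' c.
Proof. by move=> QQ' Qc x /Qc/QQ'. Qed.

Lemma linU (V : lmodType rat) (h : K -> V) x : lin h (gen x) = h x.
Proof. by rewrite /lin /= /linear_lift liftU scale1r. Qed.

Lemma supported_lift Q (V : lmodType rat) (P : V -> Prop) (h : K -> V) c :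
  submodule P -> (forall x, Q x -> P (h x)) -> supported Q c -> P (lin h c).
Proof.
move=> subP Ph; apply: (@supported_ind Q (fun c => P (lin h c))).
  exact: submodule_preim.
by move=> x Qx; rewrite linU; exact: Ph.
Qed.

End Support.

Section PushForward.
Variables (K K' : choiceType).

Definition push (f : K -> K') : {linear chain K -> chain K'} :=
  lin (fun x => gen (f x)).

Lemma pushU (f : K -> K') x : push f (gen x) = gen (f x).
Proof. exact: linU. Qed.

Lemma push_supported (f : K -> K') (Q : K' -> Prop) c :
  (forall x, Q (f x)) -> supported Q (push f c).
Proof.
move=> Qf; apply: (@supported_lift _ (fun=> True)) => //.
  exact: supported_submodule.
by move=> x _; apply: supportedU.
Qed.

Lemma push_inj (f : K -> K') : injective f -> injective (push f).
Proof.
move=> fI; apply: raddf_inj => c fc0; apply/eqP/freeg_eqP => x.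
have cE : coeff x c = coeff (f x) (push f c).
  rewrite {1 2}[c]chainE linear_sum !raddf_sum /=; apply: eq_bigr => y _.
  by rewrite linearZ /= pushU !coeffZ !coeffU (inj_eq fI).
by rewrite cE fc0 !coeff0.
Qed.

Lemma push_surj (f : K -> K') (Q : K' -> Prop) c :
  (forall y, Q y -> exists x, f x = y) -> supported Q c -> exists c', push f c' = c.
Proof.
move=> fQ; apply: (@supported_ind _ Q (fun c => exists c', push f c' = c)); last first.
  by move=> y /fQ[x <-]; exists (gen x); rewrite pushU.
split=> [|a u v [u' <-] [v' <-]]; first by exists 0; rewrite linear0.
by exists (a *: u' + v'); rewrite linearP.
Qed.

End PushForward.

Lemma homology_class0 (A B C : lmodType rat) (f : {linear A -> B})
  (g : {linear B -> C}) : homology_class f (0 : cycles g) = 0.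
Proof.
by apply: (addrI (homology_class f (0 : cycles g))); rewrite -homology_classD !addr0.
Qed.

(** * Isomorphisms of homology from linear relations *)

Section HomologyRelation.
Variables (A B C A' B' C' : lmodType rat).
Variables (f : {linear A -> B}) (g : {linear B -> C}).
Variables (f' : {linear A' -> B'}) (g' : {linear B' -> C'}).
Variable Rel : B -> B' -> Prop.
Hypothesis Rel_linear : forall k u v u' v',
  Rel u u' -> Rel v v' -> Rel (k *: u + v) (k *: u' + v').
Hypothesis Rel_left : forall u, g u = 0 -> exists2 u', g' u' = 0 & Rel u u'.
Hypothesis Rel_right : forall u', g' u' = 0 -> exists2 u, g u = 0 & Rel u u'.
Hypothesis Rel_boundary : forall u u', Rel u u' ->
  (exists a, f a = u) <-> (exists a', f' a' = u').

Local Notation hom := (homology f g).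
Local Notation hom' := (homology f' g').

Let image_exists (x : hom) : exists z' : cycles g', Rel (repr x) z'.
Proof.
case: (repr x) => u /= gu; have [|u' gu' Ruu'] := Rel_left (u := u); first exact/eqP.
by exists (@Cycle _ _ g' u' (introT eqP gu')).
Qed.

Let image (x : hom) : hom' := homology_class f' (projT1 (cid (image_exists x))).

Let image_class (z : cycles g) (z' : cycles g') : Rel z z' ->
  image (homology_class f z) = homology_class f' z'.
Proof.
move=> Rzz'; rewrite /image; case: cid => w' /= Rw.
apply/homology_classP/boundary_predP.
have R0 : Rel (cycle_val (repr (homology_class f z)) - cycle_val z)
              (cycle_val w' - cycle_val z').
  by have := Rel_linear (-1) Rzz' Rw; rewrite !scaleN1r ![- _ + _]addrC.
apply/(Rel_boundary R0).
apply/(boundary_predP f (repr (homology_class f z) - z)).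
by apply/homology_classP; rewrite homology_reprK.
Qed.

Let image_linear : linear image.
Proof.
move=> k x y; rewrite -(homology_reprK x) -(homology_reprK y).
have [x' Rx] := image_exists x; have [y' Ry] := image_exists y.
rewrite (image_class Rx) (image_class Ry).
have -> : k *: homology_class f (repr x) + homology_class f (repr y) =
          homology_class f (k *: repr x + repr y).
  by rewrite homology_classD -homology_scaleE.
have -> : k *: homology_class f' x' + homology_class f' y' =
          homology_class f' (k *: x' + y').
  by rewrite homology_classD -homology_scaleE.
by apply: image_class; exact: Rel_linear.
Qed.

(** On homology the relation becomes the graph of a bijection. Linearity reduces two partners of one
    class to their difference: boundaries going to boundaries makes the map well defined, the
    converse makes it injective, and [Rel_right] makes it onto. *)
Lemma homology_isomorphic_of_relation : lmod_isomorphic hom hom'.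
Proof.
pose phi := GRing.isLinear.Build rat hom hom' _ image image_linear.
pose im : {linear hom -> hom'} := HB.pack image phi.
have image_inj : injective im.
  apply: raddf_inj => x; have [x' Rx] := image_exists x.
  rewrite /im /= -(homology_reprK x) (image_class Rx).
  rewrite -(homology_class0 f g) -(homology_class0 f' g').
  move/homology_classP; rewrite subr0 => /boundary_predP h.
  by apply/homology_classP; rewrite subr0; apply/boundary_predP/(Rel_boundary Rx).
have image_surj y : exists x, im x = y.
  rewrite -(homology_reprK y); case: (repr y) => u' gu'.
  have [|u gu Ruu'] := Rel_right (u' := u'); first exact/eqP.
  exists (homology_class f (@Cycle _ _ g u (introT eqP gu))).
  exact: image_class.
exists im; exists (fun y => projT1 (cid (image_surj y))) => [x|y]; last by case: cid.
by apply: image_inj; case: cid.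
Qed.
End HomologyRelation.

(** * Zigzags in a double complex *)

Section DoubleComplex.
Variable V : nat -> nat -> lmodType rat.
Variables (dh : forall p q, {linear V p.+1 q -> V p q})
          (dv : forall p q, {linear V p q.+1 -> V p q}).
Variable P : forall p q, V p q -> Prop.

(* The squares commute, so no signs are needed.  Only the z i j with i + j = l
   matter; the others make the family independent of equations between indices. *)
Definition zigzag (l : nat) (x : V 0 l.+1) (y : V l.+1 0)
    (z : forall i j, V i.+1 j.+1) : Prop :=
  [/\ forall i j, (i + j)%N = l -> P (z i j),
      dh _ _ (z 0 l) = x,
      forall i j, (i + j.+1)%N = l -> dv _ _ (z i j.+1) = dh _ _ (z i.+1 j) &
      dv _ _ (z l 0) = y].

(* The indices of V are shifted by one: V 0 q and V p 0 are the augmentations. *)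
Record double_complex : Prop := DoubleComplex {
  dc_submodule : forall p q, submodule (@P p q);
  dc_dhP : forall p q (u : V p.+1 q), P u -> P (dh _ _ u);
  dc_dvP : forall p q (u : V p q.+1), P u -> P (dv _ _ u);
  dc_dhh : forall p q (u : V p.+2 q), P u -> dh _ _ (dh _ _ u) = 0;
  dc_dvv : forall p q (u : V p q.+2), P u -> dv _ _ (dv _ _ u) = 0;
  dc_dhv : forall p q (u : V p.+1 q.+1), P u ->
    dh _ _ (dv _ _ u) = dv _ _ (dh _ _ u)
}.

(** Exactness on a single antidiagonal, that of index sum [k.+1], since its transpose has to be
    provable for columns under a slack bound. The first clause is the end of a row, where every
    element is a cycle. *)
Definition rows_exact (k : nat) : Prop :=
  (forall u : V 0 k.+1, P u -> exists2 v, P v & dh _ _ v = u) /\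
  (forall p q (u : V p.+1 q.+1), (p.+1 + q)%N = k -> P u -> dh _ _ u = 0 ->
     exists2 v, P v & dh _ _ v = u).

Lemma zigzagP l x y z k x' y' z' : zigzag (l := l) x y z -> zigzag x' y' z' ->
  double_complex ->
  zigzag (k *: x + x') (k *: y + y') (fun i j => k *: z i j + z' i j).
Proof.
move=> [zP <- zE <-] [zP' <- zE' <-] dc; split=> [i j ij||i j ij|].
- by case: (dc_submodule dc i.+1 j.+1) => _; apply; [exact: zP|exact: zP'].
- by rewrite linearP.
- by rewrite !linearP zE // zE'.
- by rewrite linearP.
Qed.

(** The default 0 makes this total, so the recursions below run over all indices; existence of a
    preimage is argued only on the antidiagonal in use. *)
Let lift p q (u : V p q) : V p.+1 q :=
  xget 0 [set v | P v /\ dh _ _ v = u].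

Let liftP p q (u : V p q) : (exists2 v, P v & dh _ _ v = u) ->
  P (lift u) /\ dh _ _ (lift u) = u.
Proof.
by move=> [v Pv vu]; rewrite /lift; case: xgetP => [w _ //|/(_ v)[]].
Qed.

(** A staircase: lift along a row, descend by [dv], lift again. Each descended element is a row
    cycle because the squares commute and the element lifted before it is a column cycle. *)
Lemma zigzag_exists l (x : V 0 l.+1) : double_complex -> rows_exact l ->
  P x -> dv _ _ x = 0 ->
  exists y z, [/\ zigzag x y z, P y & dh _ _ y = 0].
Proof.
move=> dc [ex0 exS] Px dx0.
(* [x] lives in one degree; extending it by 0 to all [j] lets [r] be defined without transport along
   [i + j = l]. *)
pose X := @dfwith _ (fun j => V 0 j.+1) (fun j => 0) l x.
have XE : X l = x by exact: dfwith_in.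
pose r := fix r i : forall j, V i j.+1 :=
  if i is i'.+1 then fun j => dv _ _ (lift (r i' j.+1)) else X.
have rP i j : (i + j)%N = l -> [/\ P (r i j), dv _ _ (r i j) = 0,
    P (lift (r i j)) & dh _ _ (lift (r i j)) = r i j].
  elim: i j => [|i IH] j ijl.
    have -> : j = l by rewrite -ijl.
    by rewrite /= XE; case: (liftP (ex0 _ Px)).
  have /IH[_ dr Plr dlr] : (i + j.+1)%N = l by rewrite addnS.
  have Pr : P (r i.+1 j) by exact: dc_dvP.
  have dr0 : dh _ _ (r i.+1 j) = 0 by rewrite /= dc_dhv // dlr.
  by case: (liftP (exS _ _ _ ijl Pr dr0)); split=> //=; exact: dc_dvv.
pose z i j := lift (r i j).
have [_ _ zl0 zl0E] := rP l 0%N (addn0 l).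
exists (dv _ _ (z l 0%N)), z; split; first split=> //.
- by move=> i j /rP[].
- by rewrite /z; case: (rP 0%N l erefl) => _ _ _ ->.
- by move=> i j ijl; rewrite /z; case: (rP i.+1 j) => [|_ _ _ ->]; rewrite // addSnnS.
- exact: dc_dvP.
- by rewrite dc_dhv // zl0E; case: (rP l 0%N (addn0 l)).
Qed.

(** The staircase is repeated one degree higher, starting from [w] and correcting by [z]: what is
    lifted next is [z i j] minus the descended previous lift. The identity
    [dv (r i j.+1) = dh (z i j)], carried along, makes this difference a row cycle. The last lift,
    once descended, has [y] as its row boundary. *)
Lemma zigzag_boundary l x y z (w : V 0 l.+2) : double_complex ->
  rows_exact l.+1 -> zigzag (l := l) x y z -> P w -> dv _ _ w = x ->
  exists2 v, P v & dh _ _ v = y.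
Proof.
move=> dc [ex0 exS] [zP z0 zS <-] Pw wx.
pose W := @dfwith _ (fun j => V 0 j.+1) (fun j => 0) l.+1 w.
have WE : W l.+1 = w by exact: dfwith_in.
pose r := fix r i : forall j, V i j.+1 :=
  if i is i'.+1 then fun j => z i' j - dv _ _ (lift (r i' j.+1)) else W.
have step i j : (i + j)%N = l -> [/\ P (lift (r i j.+1)),
      dh _ _ (lift (r i j.+1)) = r i j.+1 & dv _ _ (r i j.+1) = dh _ _ (z i j)] ->
    P (lift (r i.+1 j)) /\ dh _ _ (lift (r i.+1 j)) = r i.+1 j.
  move=> ijl [Plr dlr drz]; apply/liftP/exS; first by rewrite addSn ijl.
    by apply: submoduleB; [exact: dc_submodule|exact: zP|exact: dc_dvP].
  by rewrite /= linearB /= (dc_dhv dc Plr) dlr drz subrr.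
have rP i j : (i + j)%N = l -> [/\ P (lift (r i j.+1)),
    dh _ _ (lift (r i j.+1)) = r i j.+1 & dv _ _ (r i j.+1) = dh _ _ (z i j)].
  elim: i j => [|i IH] j ijl.
    have -> : j = l by rewrite -ijl.
    by rewrite /= WE z0; case: (liftP (ex0 _ Pw)).
  have ij : (i + j.+1)%N = l by rewrite addnS.
  have [Plr dlr] := step _ _ ij (IH _ ij); split=> //.
  have [Plr' _ _] := IH _ ij.
  by rewrite -zS // [r i.+1 _]/= linearB /= (dc_dvv dc Plr') subr0.
have [Plr dlr] := step _ _ (addn0 l) (rP _ _ (addn0 l)).
exists (dv _ _ (lift (r l.+1 0%N))); first exact: dc_dvP.
rewrite (dc_dhv dc Plr) dlr [r _ _]/= linearB /= dc_dvv ?subr0 //.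
by case: (rP l 0%N (addn0 l)).
Qed.
End DoubleComplex.

Section Transpose.
Variable V : nat -> nat -> lmodType rat.
Variables (dh : forall p q, {linear V p.+1 q -> V p q})
          (dv : forall p q, {linear V p q.+1 -> V p q}).
Variable P : forall p q, V p q -> Prop.
Arguments P {p q} _.

Let V' p q := V q p.
Let dh' p q : {linear V' p.+1 q -> V' p q} := dv q p.
Let dv' p q : {linear V' p q.+1 -> V' p q} := dh q p.
Let P' p q (u : V' p q) : Prop := P (u : V q p).

Lemma zigzag_transpose l x y z : zigzag dh' dv' P' (l := l) y x (fun i j => z j i) <->
  zigzag dh dv (@P) (l := l) x y z.
Proof.
split=> -[zP z0 zS zl]; split=> // i j ijl; do ?[by apply: zP; rewrite addnC].
- by symmetry; apply: (zS j i); rewrite addnS -addSn addnC.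
- by symmetry; apply: (zS j i); rewrite addnS -addSn addnC.
Qed.

(** Commuting squares, unlike anticommuting ones, are symmetric in the two directions without any
    change of sign. *)
Lemma double_complex_transpose : double_complex dh dv (@P) -> double_complex dh' dv' P'.
Proof.
move=> dc; split=> p q; first exact: (dc_submodule dc).
- exact: (dc_dvP dc).
- exact: (dc_dhP dc).
- exact: (dc_dvv dc).
- exact: (dc_dhh dc).
- by move=> u Pu; rewrite [RHS](dc_dhv dc).
Qed.

Definition columns_exact (k : nat) : Prop :=
  (forall u : V k.+1 0, P u -> exists2 v, P v & dv _ _ v = u) /\
  (forall p q (u : V p.+1 q.+1), (p + q.+1)%N = k -> P u -> dv _ _ u = 0 ->
     exists2 v, P v & dv _ _ v = u).

Lemma rows_exact_transpose k : columns_exact k -> rows_exact dh' P' k.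
Proof. by move=> [ex0 exS]; split=> // p q u pq; apply: exS; rewrite addnC. Qed.

Lemma zigzag_exists_bottom l (y : V l.+1 0) : double_complex dh dv (@P) ->
  columns_exact l -> P y -> dh _ _ y = 0 ->
  exists x z, [/\ zigzag dh dv (@P) x y z, P x & dv _ _ x = 0].
Proof.
move=> /double_complex_transpose dc /rows_exact_transpose ex Py dy.
have [x [z [zz Px dx]]] := zigzag_exists dc ex Py dy.
by exists x, (fun i j => z j i); split=> //; apply/zigzag_transpose.
Qed.

Lemma zigzag_boundary_bottom l x y z (w : V l.+2 0) : double_complex dh dv (@P) ->
  columns_exact l.+1 -> zigzag dh dv (@P) (l := l) x y z -> P w -> dh _ _ w = y ->
  exists2 v, P v & dv _ _ v = x.
Proof.
move=> /double_complex_transpose dc /rows_exact_transpose ex /zigzag_transpose zz.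
exact: (zigzag_boundary dc ex zz).
Qed.

End Transpose.

(** * Barycentric subdivision of affine chains *)

(* A seq of points is an affine simplex, the empty seq being the generator in
   degree -1, so that bd is the differential of the augmented complex. *)
Section AffineChains.
Variable V : choiceType.
Local Notation L := (chain (seq V)).
Implicit Types (s t : seq V) (c : L).

Definition cone (v : V) : {linear L -> L} := push (cons v).

(** The alternating sum of faces in the form $\partial(vs) = s - v\,\partial s$, which needs no
    special case for points since faces may be empty. [seq_boundaryE] gives the usual sum. *)
Fixpoint seq_boundary s : L :=
  if s is v :: s' then (gen (s')) - cone v (seq_boundary s') else 0.

Definition affine_boundary : {linear L -> L} := lin seq_boundary.
Local Notation bd := affine_boundary.

Lemma affine_boundaryU s : bd (gen s) = seq_boundary s.
Proof. exact: linU. Qed.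

Lemma coneU v s : cone v (gen s) = (gen (v :: s)).
Proof. exact: pushU. Qed.

Lemma boundary_cone v c : bd (cone v c) = c - cone v (bd c).
Proof.
apply: (@supported_ind _ (fun=> True) (fun c => bd (cone v c) = c - cone v (bd c))) => //.
  exact: (submodule_eq (bd \o cone v) (idfun \- (cone v \o bd))).
by move=> s _; rewrite coneU !affine_boundaryU.
Qed.

Lemma boundary_boundary c : bd (bd c) = 0.
Proof.
suff h s : bd (bd (gen s)) = 0.
  apply: (@supported_ind _ (fun=> True) (fun c => bd (bd c) = 0)) => //.
  by split=> [|a x y hx hy]; rewrite ?linear0 // !linearP hx hy scaler0 addr0.
elim: s => [|v s IH]; first by rewrite affine_boundaryU linear0.
rewrite affine_boundaryU /= linearB /= boundary_cone -affine_boundaryU.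
by rewrite IH linear0 subr0 subrr.
Qed.

Definition of_size n s : Prop := size s = n.

Lemma cone_supported (Q Q' : seq V -> Prop) v c :
  (forall s, Q s -> Q' (v :: s)) -> supported Q c -> supported Q' (cone v c).
Proof.
move=> QQ'; apply: (@supported_lift _ Q _ (supported Q')).
  exact: supported_submodule.
by move=> s Qs; apply: supportedU; exact: QQ'.
Qed.

Lemma seq_boundary_size s n : size s = n.+1 -> supported (of_size n) (seq_boundary s).
Proof.
elim: s n => [//|v s IH] n [sn] /=; apply: (submoduleB (supported_submodule _)).
  exact: supportedU.
case: n sn => [|n] sn.
  by rewrite (size0nil sn) /= linear0; exact: (submodule0 (supported_submodule _)).
by apply: cone_supported (IH _ sn) => t /= <-.
Qed.

Section Recursion.
Variables (base : L) (G : seq V -> L -> L).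

(** Subdivision and its homotopy are determined on a simplex by their values on its boundary, which
    is a chain and not a subterm. The size serves as fuel: every face of a simplex of size [n.+1]
    has size exactly [n]. *)
Fixpoint boundary_rec_fuel n s : L :=
  if n is n'.+1 then G s (lin (boundary_rec_fuel n') (seq_boundary s))
  else base.

Definition boundary_rec : {linear L -> L} :=
  lin (fun s => boundary_rec_fuel (size s) s).

Let boundary_recU s : boundary_rec (gen s) = boundary_rec_fuel (size s) s.
Proof. exact: linU. Qed.

Lemma boundary_rec_nil : boundary_rec (gen ([::])) = base.
Proof. exact: boundary_recU. Qed.

Lemma boundary_rec_cons v s :
  boundary_rec (gen (v :: s)) = G (v :: s) (boundary_rec (seq_boundary (v :: s))).
Proof.
rewrite boundary_recU; congr (G _ _).
apply: (@supported_eq _ (of_size (size s)) _ (lin _) boundary_rec).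
  2: exact: seq_boundary_size.
by move=> t ts; rewrite boundary_recU ts; exact: linU.
Qed.

End Recursion.

Section Subdivision.
Variable bary : seq V -> V.

Definition subdivision : {linear L -> L} :=
  boundary_rec (gen ([::])) (fun s c => cone (bary s) c).

Definition subdivision_homotopy : {linear L -> L} :=
  boundary_rec 0 (fun s c => cone (bary s) ((gen s) - c)).

Local Notation Sd := subdivision.
Local Notation Th := subdivision_homotopy.

Lemma subdivision_boundary c : bd (Sd c) = Sd (bd c).
Proof.
suff h n s : (size s <= n)%N -> bd (Sd (gen s)) = Sd (bd (gen s)).
  apply: (@supported_ind _ (fun=> True) (fun c => bd (Sd c) = Sd (bd c))) => //.
    exact: (submodule_eq (bd \o Sd) (Sd \o bd)).
  by move=> s _; exact: h (leqnn _).
elim: n s => [|n IH] [|v s] // sn.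
- by rewrite boundary_rec_nil affine_boundaryU linear0.
- by rewrite boundary_rec_nil affine_boundaryU linear0.
rewrite boundary_rec_cons boundary_cone affine_boundaryU.
suff -> : bd (Sd (seq_boundary (v :: s))) = 0 by rewrite linear0 subr0.
rewrite (_ : bd _ = Sd (bd (seq_boundary (v :: s)))).
  by rewrite -affine_boundaryU boundary_boundary linear0.
apply: (@supported_ind _ (of_size (size s)) (fun c => bd (Sd c) = Sd (bd c))).
- exact: (submodule_eq (bd \o Sd) (Sd \o bd)).
- by move=> t ts; apply: IH; rewrite ts.
- exact: seq_boundary_size.
Qed.

(** By induction the boundary of [s - Th (bd s)] is [Sd (bd s)], whose cone from the barycenter is
    [Sd s]. Coning [s - Th (bd s)] thus leaves [s - Th (bd s) - Sd s] as boundary. *)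
Lemma subdivision_homotopyP c : c - Sd c = bd (Th c) + Th (bd c).
Proof.
pose P c := c - Sd c = bd (Th c) + Th (bd c).
have subP : submodule P.
  exact: (submodule_eq (idfun \- Sd) ((bd \o Th) \+ (Th \o bd))).
suff h n s : (size s <= n)%N -> P (gen s).
  by apply: (@supported_ind _ (fun=> True) P) => // s _; exact: h (leqnn _).
have h0 : P (gen ([::])).
  by rewrite /P !boundary_rec_nil affine_boundaryU !linear0 subrr addr0.
elim: n s => [|n IH] [|v s] // sn; rewrite /P.
rewrite [Sd (gen _)]boundary_rec_cons [Th (gen _)]boundary_rec_cons.
rewrite boundary_cone affine_boundaryU.
set b := seq_boundary _.
have /eqP : P b.
  apply: (@supported_ind _ (of_size (size s)) P) => //; last exact: seq_boundary_size.
  by move=> t ts; apply: IH; rewrite ts.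
have -> : bd b = 0 by rewrite /b -affine_boundaryU boundary_boundary.
rewrite linear0 addr0 => /eqP bE.
have -> : bd ((gen (v :: s)) - Th b) = Sd b.
  by rewrite linearB /= affine_boundaryU -/b -bE opprB addrCA subrr addr0.
by rewrite addrAC subrK.
Qed.

Fixpoint iter_subdivision m : {linear L -> L} :=
  if m is m'.+1 then (Sd \o iter_subdivision m')%FUN else idfun.

Fixpoint iter_homotopy m : {linear L -> L} :=
  if m is m'.+1 then iter_homotopy m' \+ (Th \o iter_subdivision m')%FUN else \0.

Lemma iter_subdivisionS m c : iter_subdivision m.+1 c = Sd (iter_subdivision m c).
Proof. by []. Qed.

Lemma iter_homotopyS m c :
  iter_homotopy m.+1 c = iter_homotopy m c + Th (iter_subdivision m c).
Proof. by []. Qed.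

Lemma iter_subdivision_boundary m c :
  bd (iter_subdivision m c) = iter_subdivision m (bd c).
Proof.
by elim: m => // m IH; rewrite !iter_subdivisionS subdivision_boundary IH.
Qed.

(** A telescoping sum, since [Sd] commutes with [bd]. *)
Lemma iter_homotopyP m c :
  c - iter_subdivision m c = bd (iter_homotopy m c) + iter_homotopy m (bd c).
Proof.
elim: m => [|m IH]; first by rewrite subrr linear0 addr0.
rewrite !iter_homotopyS iter_subdivisionS linearD addrACA -IH -iter_subdivision_boundary.
by rewrite -subdivision_homotopyP addrA subrK.
Qed.

Lemma seq_boundary_face s :
  supported (fun t => size t = (size s).-1 /\ {subset t <= s}) (seq_boundary s).
Proof.
elim: s => [|v s IH] /=; first exact: (submodule0 (supported_submodule _)).
apply: (submoduleB (supported_submodule _)).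
  by apply: supportedU; split=> // x xs; rewrite inE xs orbT.
case: s IH => [|w s] IH.
  by rewrite /= linear0; exact: (submodule0 (supported_submodule _)).
apply: cone_supported IH => t [ts tw]; split=> [|x]; first by rewrite /= ts.
by rewrite !inE => /orP[->//|/tw]; rewrite inE => ->; rewrite orbT.
Qed.

(** A simplex of [Sd s] lists the barycenters of a descending flag of faces, so a property of such
    simplices can be carried from a facet [s'] up to [s]. *)
Lemma subdivision_supported (Q : seq V -> seq V -> Prop) :
  Q [::] [::] ->
  (forall s s' t, size s = (size s').+1 -> {subset s' <= s} -> Q s' t ->
     Q s (bary s :: t)) ->
  forall s, supported (Q s) (Sd (gen s)).
Proof.
move=> Q0 QS s; have [n] := ubnP (size s); elim: n s => // n IH [|v s] sn.
  by rewrite boundary_rec_nil; exact: supportedU.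
rewrite boundary_rec_cons; set w := v :: s.
pose Q' t := exists2 s', size s' = size s /\ {subset s' <= w} & Q s' t.
apply: (@cone_supported Q').
  by move=> t [s' [s's s'w] Q't]; apply: QS Q't; rewrite ?s's.
apply: (@supported_ind _ (fun t => size t = (size w).-1 /\ {subset t <= w})
   (fun c => supported Q' (Sd c))); last exact: seq_boundary_face.
  exact/submodule_preim/supported_submodule.
move=> t [/= ts tw]; have /IH : (size t < n)%N by rewrite ts.
by apply: supported_sub => u Qu; exists t.
Qed.

End Subdivision.
End AffineChains.

(** * Naturality of subdivision under maps of vertices *)

Section AffineNaturality.
Variables (V V' : choiceType) (f : V -> V').
Variables (bary : seq V -> V) (bary' : seq V' -> V').
Hypothesis f_bary : forall v s, f (bary (v :: s)) = bary' (map f (v :: s)).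

Local Notation pf := (push (map f)).

Lemma push_cone v c : pf (cone v c) = cone (f v) (pf c).
Proof.
apply: (@chain_linear_eq _ _ (pf \o cone v) (cone (f v) \o pf)) => s.
change (pf (cone v (gen s)) = cone (f v) (pf (gen s))).
by rewrite coneU !pushU.
Qed.

Lemma push_boundary c : pf (affine_boundary V c) = affine_boundary V' (pf c).
Proof.
apply: (@chain_linear_eq _ _ (pf \o affine_boundary V) (affine_boundary V' \o pf)) => s.
change (pf (affine_boundary V (gen s)) = affine_boundary V' (pf (gen s))).
rewrite pushU !affine_boundaryU; elim: s => [|v s IH] /=; first exact: linear0.
by rewrite linearB [X in X - _]pushU push_cone IH.
Qed.

Let push_rec base base' (G : seq V -> (chain (seq V)) -> (chain (seq V)))
    (G' : seq V' -> (chain (seq V')) -> (chain (seq V'))) :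
  pf base = base' ->
  (forall v s c, pf (G (v :: s) c) = G' (map f (v :: s)) (pf c)) ->
  forall c, pf (boundary_rec base G c) = boundary_rec base' G' (pf c).
Proof.
move=> bE GE; apply: (@chain_linear_eq _ _ (pf \o boundary_rec base G)
  (boundary_rec base' G' \o pf)) => s.
change (pf (boundary_rec base G (gen s)) = boundary_rec base' G' (pf (gen s))).
have [n] := ubnP (size s); elim: n s => // n IH [|v s] sn.
  by rewrite pushU !boundary_rec_nil.
have bdE : seq_boundary (map f (v :: s)) = pf (seq_boundary (v :: s)).
  by rewrite -!affine_boundaryU push_boundary pushU.
rewrite pushU [map _ _]/= !boundary_rec_cons GE -[f v :: _]/(map f (v :: s)) bdE.
congr (G' _ _).
apply: (@supported_eq _ (of_size (size s)) _ (pf \o boundary_rec base G)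
  (boundary_rec base' G' \o pf)); last exact: seq_boundary_size.
by move=> t ts; apply: IH; rewrite ts.
Qed.

Lemma push_subdivision c : pf (subdivision bary c) = subdivision bary' (pf c).
Proof. by apply: push_rec => [|v s d]; rewrite ?pushU // push_cone f_bary. Qed.

Lemma push_homotopy c :
  pf (subdivision_homotopy bary c) = subdivision_homotopy bary' (pf c).
Proof.
apply: push_rec => [|v s d]; first exact: linear0.
by rewrite push_cone f_bary linearB [X in X - _]pushU.
Qed.

Lemma push_iter_subdivision m c :
  pf (iter_subdivision bary m c) = iter_subdivision bary' m (pf c).
Proof.
by elim: m => // m IH; rewrite !iter_subdivisionS push_subdivision IH.
Qed.

Lemma push_iter_homotopy m c :
  pf (iter_homotopy bary m c) = iter_homotopy bary' m (pf c).
Proof.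
elim: m => [|m IH]; first exact: linear0.
by rewrite !iter_homotopyS linearD IH push_homotopy push_iter_subdivision.
Qed.

End AffineNaturality.

(** * Small singular chains *)

Section AffineSimplices.
Variable R : realType.
Local Notation Delta n := (@std_simplex R n).

Lemma vertex_subproof n (i : 'I_n.+1) : delta_mx 0 i \in Delta n.
Proof.
rewrite inE; split=> [j|]; first by rewrite mxE ler0n.
rewrite (bigD1 i) //= mxE !eqxx big1 ?addr0 // => j ji.
by rewrite mxE (negbTE ji) andbF.
Qed.

Definition vertex n (i : 'I_n.+1) : Delta n := exist _ (delta_mx 0 i) (vertex_subproof i).

Lemma std_simplex0 (x : Delta 0) : x = vertex ord0.
Proof.
apply/val_inj/rowP => i; have /= [_] := set_valP x.
by rewrite big_ord1 => x1; rewrite (ord1 i) mxE !eqxx; exact: x1.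
Qed.

Lemma uniform_subproof n : const_mx n.+1%:R^-1 \in Delta n.
Proof.
rewrite inE; split=> [j|]; first by rewrite mxE invr_ge0 ler0n.
under eq_bigr do rewrite mxE.
by rewrite sumr_const card_ord -[LHS]mulr_natr mulVf // pnatr_eq0.
Qed.

Definition uniform n : Delta n := exist _ (const_mx n.+1%:R^-1) (uniform_subproof n).

Section AffineMap.
Variables (n k : nat) (s : seq (Delta n)).

(** The default vertex in [nth] keeps the value inside the simplex for every [s], so no size
    condition enters the type. *)
Definition affine_fun (x : 'rV[R]_k.+1) : 'rV[R]_n.+1 :=
  \sum_i x 0 i *: set_val (nth (vertex ord0) s i).

Lemma affine_subproof (x : Delta k) : affine_fun (set_val x) \in Delta n.
Proof.
have /= [x0 x1] := set_valP x; rewrite inE; split=> [j|].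
  rewrite summxE sumr_ge0 // => i _; rewrite mxE mulr_ge0 //.
  by have /= [] := set_valP (nth (vertex ord0) s i).
under eq_bigr do rewrite summxE.
rewrite exchange_big /= -[RHS]x1; apply: eq_bigr => i _.
under eq_bigr do rewrite mxE.
rewrite -mulr_sumr; have /= [_ ->] := set_valP (nth (vertex ord0) s i).
exact: mulr1.
Qed.

Definition affine_map (x : Delta k) : Delta n :=
  exist _ (affine_fun (set_val x)) (affine_subproof x).

Lemma affine_fun_continuous : continuous affine_fun.
Proof.
apply: continuous_big => [|i _ x]; first exact: add_continuous.
by apply: (@cvgZr_tmp _ _ _ (nbhs x)); exact: coord_continuous.
Qed.

Lemma affine_map_continuous : continuous affine_map.
Proof.
apply: continuous_comp_initial.
have -> : set_val \o affine_map = affine_fun \o set_val by [].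
move=> x; apply: continuous_comp; first exact: initial_continuous.
exact: affine_fun_continuous.
Qed.

HB.instance Definition _ := isContinuous.Build _ _ affine_map affine_map_continuous.

End AffineMap.

Section Delete.
Variable A : Type.

Definition delete i (s : seq A) : seq A := take i s ++ drop i.+1 s.

Lemma size_delete i s k : (i < k.+1)%N -> size s = k.+1 -> size (delete i s) = k.
Proof.
move=> ik sk; rewrite size_cat size_take size_drop sk ik.
by rewrite subSS subnKC.
Qed.

Lemma nth_delete x0 i s j : (i < size s)%N -> nth x0 (delete i s) j = nth x0 s (bump i j).
Proof.
move=> ik; rewrite nth_cat size_take ik /bump.
case: ltnP => ki; first by rewrite nth_take.
by rewrite nth_drop; congr nth; rewrite addSn subnKC.
Qed.

End Delete.

Lemma seq_boundaryE (V : choiceType) (s : seq V) :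
  seq_boundary s = \sum_(i < size s) (-1) ^+ i *: gen (delete i s).
Proof.
elim: s => [|v s IH] /=; first by rewrite big_ord0.
rewrite big_ord_recl expr0 scale1r /delete /= drop0 IH linear_sum -sumrN; congr +%R.
apply: eq_bigr => i _; rewrite linearZ exprS mulN1r scaleNr; congr (- (_ *: _)).
exact: coneU.
Qed.

Lemma affine_map_coface n k (s : seq (Delta n)) (i : 'I_k.+2) (x : Delta k) :
  size s = k.+2 ->
  affine_map s (coface i x) = affine_map (delete i s) x.
Proof.
move=> sk; apply/val_inj => /=; rewrite /affine_fun (bigD1_ord i) //=.
rewrite mxE unlift_none scale0r add0r; apply: eq_bigr => j _.
by rewrite mxE liftK nth_delete ?sk.
Qed.

Lemma coface_affine_map n k (s : seq (Delta n)) (i : 'I_n.+2) (x : Delta k) :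
  size s = k.+1 ->
  coface i (affine_map s x) = affine_map (map (coface i) s) x.
Proof.
move=> sk; apply/val_inj => /=; rewrite /affine_fun; apply/rowP => j.
rewrite mxE !summxE; case: unliftP => [l ->|->].
  rewrite summxE; apply: eq_bigr => m _.
  by rewrite (nth_map (vertex ord0)) ?sk // !mxE liftK.
rewrite big1 // => m _.
by rewrite (nth_map (vertex ord0)) ?sk // !mxE unlift_none mulr0.
Qed.

Definition vertices n : seq (Delta n) := [seq vertex i | i <- enum 'I_n.+1].

Lemma size_vertices n : size (vertices n) = n.+1.
Proof. by rewrite size_map size_enum_ord. Qed.

Lemma nth_vertices n (i : 'I_n.+1) : nth (vertex ord0) (vertices n) i = vertex i.
Proof. by rewrite (nth_map ord0) ?size_enum_ord // nth_ord_enum. Qed.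

Lemma affine_map_vertices n (x : Delta n) : affine_map (vertices n) x = x.
Proof.
apply/val_inj => /=; rewrite /affine_fun [RHS]row_sum_delta.
by apply: eq_bigr => i _; rewrite nth_vertices.
Qed.

Lemma coface_vertex n (i : 'I_n.+2) (j : 'I_n.+1) :
  coface i (vertex j) = vertex (fintype.lift i j).
Proof.
apply/val_inj/rowP => l; rewrite /= mxE; case: unliftP => [m ->|->]; rewrite !mxE.
  by rewrite (inj_eq lift_inj).
by rewrite (negbTE (neq_lift _ _)) andbF.
Qed.

Lemma map_coface_vertices n (i : 'I_n.+2) :
  map (coface i) (vertices n) = delete i (vertices n.+1).
Proof.
apply: (@eq_from_nth _ (vertex ord0)).
  by rewrite size_map size_vertices (@size_delete _ _ _ n.+1) // size_vertices.
move=> j; rewrite size_map size_vertices => jn.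
rewrite (nth_map (vertex ord0)) ?size_vertices // nth_delete ?size_vertices //.
have -> : j = Ordinal jn by [].
by rewrite nth_vertices coface_vertex -nth_vertices.
Qed.

Definition barycenter n (s : seq (Delta n)) : Delta n :=
  affine_map s (uniform (size s).-1).

(** The barycenter of the empty sequence is the default vertex, which a coface may move; hence the
    nonempty sequence here and in [f_bary]. *)
Lemma coface_barycenter n (i : 'I_n.+2) v (s : seq (Delta n)) :
  coface i (barycenter (v :: s)) = barycenter (map (coface i) (v :: s)).
Proof.
by rewrite /barycenter coface_affine_map //= size_map.
Qed.

Section Realization.
Variable T : topologicalType.

Definition affine_simplex n (sigma : singular_simplex R T n) k (s : seq (Delta n)) :
  singular_simplex R T k := sigma \o affine_map s.

(** Affine chains of all sizes share one module; this map keeps those of dimension [k] and sends the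
    rest to 0. *)
Definition realize n (sigma : singular_simplex R T n) k :
    {linear chain (seq (Delta n)) -> chain (singular_simplex R T k)} :=
  lin (fun s => if size s == k.+1 then gen (affine_simplex sigma k s) else 0).

Definition sing_boundary k :
    {linear chain (singular_simplex R T k.+1) -> chain (singular_simplex R T k)} :=
  boundary (singular_set R T) k.

Lemma sing_boundaryU k (sigma : singular_simplex R T k.+1) :
  sing_boundary k (gen sigma) =
  \sum_(i < k.+2) (-1) ^+ i *: gen (singular_face i sigma).
Proof. exact: linU. Qed.

Lemma realizeU n (sigma : singular_simplex R T n) k s :
  realize sigma k (gen s) = if size s == k.+1 then gen (affine_simplex sigma k s) else 0.
Proof. exact: linU. Qed.

Lemma boundary_realize n (sigma : singular_simplex R T n) k c :
  sing_boundary k (realize sigma k.+1 c) = realize sigma k (affine_boundary _ c).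
Proof.
apply: (@chain_linear_eq _ _ (sing_boundary k \o realize sigma k.+1)
  (realize sigma k \o affine_boundary _)) => s.
change (sing_boundary k (realize sigma k.+1 (gen s)) =
        realize sigma k (affine_boundary _ (gen s))).
rewrite affine_boundaryU realizeU; case: eqP => sk.
  rewrite sing_boundaryU seq_boundaryE sk linear_sum; apply: eq_bigr => i _.
  rewrite linearZ /= realizeU (size_delete _ sk) // eqxx; congr (_ *: gen _).
  by apply/continuousEP => x /=; rewrite affine_map_coface.
case: s sk => [|v s] sk; first by rewrite !linear0.
rewrite linear0; apply: esym.
apply: (@supported_eq _ (of_size (size s)) _ (realize sigma k) \0).
  by move=> t ts; rewrite realizeU ts; case: eqP sk => // <-.
exact: seq_boundary_size.
Qed.

Lemma realize_face n (sigma : singular_simplex R T n.+1) i k c :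
  realize (singular_face i sigma) k c = realize sigma k (push (map (coface i)) c).
Proof.
apply: (@chain_linear_eq _ _ (realize (singular_face i sigma) k)
  (realize sigma k \o push (map (coface i)))) => s.
change (realize (singular_face i sigma) k (gen s) =
        realize sigma k (push (map (coface i)) (gen s))).
rewrite pushU !realizeU size_map; case: eqP => // sk; congr gen.
by apply/continuousEP => x /=; rewrite coface_affine_map.
Qed.

Lemma realize_vertices n (sigma : singular_simplex R T n) :
  realize sigma n (gen (vertices n)) = gen sigma.
Proof.
rewrite realizeU size_vertices eqxx; congr gen.
by apply/continuousEP => x /=; rewrite affine_map_vertices.
Qed.

End Realization.
End AffineSimplices.

(** * Diameters under barycentric subdivision *)

Section Mesh.
Variables (R : realType) (n : nat).
Local Notation Delta n := (@std_simplex R n).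
Implicit Types (s t : seq (Delta n)).

Lemma simplex_norm (x : Delta n) : `|set_val x| <= 1.
Proof.
have /= [x0 x1] := set_valP x.
rewrite [leLHS]/Num.norm /= mx_normrE; apply/bigmax_leP; split=> // -[i j] _ /=.
rewrite ord1 ger0_norm // -x1 (bigD1 j) //= lerDl; exact: sumr_ge0.
Qed.

Definition diam_le s (d : R) : Prop :=
  forall v w, v \in s -> w \in s -> `|set_val v - set_val w| <= d.

(** Balls are convex: [q] minus a convex combination is the same combination of the differences. *)
Lemma affine_map_norm k s (x : Delta k) (q : 'rV[R]_n.+1) (r : R) :
  size s = k.+1 -> (forall w, w \in s -> `|q - set_val w| <= r) ->
  `|q - set_val (affine_map s x)| <= r.
Proof.
move=> sk qr; have /= [x0 x1] := set_valP x.
have -> : q - set_val (affine_map s x) =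
    \sum_i set_val x 0 i *: (q - set_val (nth (vertex _ ord0) s i)).
  under eq_bigr do rewrite scalerBr.
  by rewrite sumrB -scaler_suml x1 scale1r.
rewrite (le_trans (ler_norm_sum _ _ _)) // -[leRHS]mul1r -x1 mulr_suml.
apply: ler_sum => i _; rewrite normrZ ger0_norm // ler_wpM2l //.
by apply/qr/mem_nth; rewrite sk.
Qed.

(** The difference is the average of the differences between [w] and all points of [s]. The term of
    [w] itself vanishes, which leaves [k] of [k.+1] terms and the factor below 1. *)
Lemma barycenter_dist s (N : nat) (d : R) w : (size s <= N.+1)%N ->
  diam_le s d -> w \in s -> `|set_val w - set_val (barycenter s)| <= N%:R / N.+1%:R * d.
Proof.
move=> sN sd ws; have d0 : 0 <= d.
  by apply: le_trans (sd _ _ ws ws); exact: normr_ge0.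
case: s => // [v s'] in ws sN sd *; set s := v :: s' in ws sN sd *.
set k := size s' in sN *.
have -> : set_val w - set_val (barycenter s) =
    \sum_(i < k.+1) k.+1%:R^-1 *: (set_val w - set_val (nth (vertex _ ord0) s i)).
  under eq_bigr do rewrite scalerBr.
  rewrite sumrB sumr_const card_ord -scaler_nat scalerA mulfV ?pnatr_eq0 //.
  rewrite scale1r /barycenter /= /affine_fun; congr (_ - _).
  by apply: eq_bigr => i _; rewrite mxE.
have wk : (index w s < k.+1)%N by rewrite index_mem.
rewrite (bigD1 (Ordinal wk)) //= nth_index // subrr scaler0 add0r.
rewrite (le_trans (ler_norm_sum _ _ _)) //.
apply: (@le_trans _ _ (\sum_(i < k.+1 | i != Ordinal wk) k.+1%:R^-1 * d)).
  apply: ler_sum => i _; rewrite normrZ ger0_norm ?invr_ge0 ?ler0n //.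
  by rewrite ler_wpM2l ?invr_ge0 ?ler0n // sd // mem_nth.
rewrite sumr_const cardC1 card_ord /= -mulrnAl ler_wpM2r // -[leLHS]mulr_natl.
rewrite ler_pdivlMr ?ltr0n // mulrAC ler_pdivrMr ?ltr0n //.
by rewrite -!natrM ler_nat !mulnS mulnC leq_add2r.
Qed.

Definition ratio : R := n%:R / n.+1%:R.

(* Every ball containing s contains p: this is all that is used of the convex hull. *)
Definition in_ball_hull s (p : Delta n) : Prop :=
  forall (q : 'rV[R]_n.+1) (r : R), (forall w, w \in s -> `|q - set_val w| <= r) ->
  `|q - set_val p| <= r.

(* Membership in the hull is carried along because a new barycenter is compared
   with the points of all subdivided faces. *)
Definition mesh_shrinks s t : Prop := (size s <= n.+1)%N ->
  [/\ size t = size s, forall p, p \in t -> in_ball_hull s p &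
      forall d, diam_le s d -> diam_le t (ratio * d)].

Lemma subdivision_mesh s :
  supported (mesh_shrinks s) (subdivision (@barycenter R n) (gen s)).
Proof.
apply: subdivision_supported; first by move=> _; split.
move=> {}s s' t ss' s's IH sn.
have [|ts' th td] := IH; first by rewrite ltnW // -ss'.
have bh : in_ball_hull s (barycenter s).
  by move=> q r; apply: affine_map_norm; rewrite ss'.
have th' p : p \in t -> in_ball_hull s p.
  by move=> /th h q r qr; apply: h => w /s's; exact: qr.
split=> [|p|d sd]; first by rewrite /= ts' ss'.
  by rewrite inE => /orP[/eqP->//|/th'].
(* A point of [s] is what yields [0 <= ratio * d], for the distance of the barycenter to itself. *)
have [w0 w0s] : exists w, w \in s.
  by case: s ss' {s's sn bh th' sd} => // w s _; exists w; rewrite mem_head.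
have bd w : w \in s -> `|set_val (barycenter s) - set_val w| <= ratio * d.
  by move=> ws; rewrite distrC; exact: barycenter_dist.
move=> v w; rewrite !inE => /orP[/eqP->|vt] /orP[/eqP->|wt].
- by rewrite subrr normr0 (le_trans _ (bd _ w0s)).
- exact: th'.
- by rewrite distrC; exact: th'.
- by apply: (td d) => // a b /s's sa /s's; exact: sd.
Qed.

Lemma iter_subdivision_mesh m :
  supported (fun t => size t = n.+1 /\ diam_le t (2 * ratio ^+ m))
    (iter_subdivision (@barycenter R n) m (gen (vertices R n))).
Proof.
elim: m => [|m IH].
  apply: supportedU; rewrite size_vertices; split=> // v w _ _.
  (* The constant 2 is the sum of the norms of two points of the simplex, each at most 1. *)
  rewrite expr0 mulr1 (le_trans (ler_normB _ _)) //.
  by rewrite -[2]/(1 + 1) lerD // simplex_norm.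
rewrite iter_subdivisionS.
apply: (@supported_ind _ _ (fun c => supported _ (subdivision _ c)) _ _ _ IH).
  exact/submodule_preim/supported_submodule.
move=> s [sn sd]; apply: supported_sub (subdivision_mesh (s := s)) => t.
rewrite /mesh_shrinks sn => /(_ (leqnn _))[-> _ td]; split=> //.
by rewrite exprS mulrCA; exact: td.
Qed.

Lemma mesh_cvg (e : R) : 0 < e ->
  exists M, forall m, (M <= m)%N -> 2 * ratio ^+ m < e.
Proof.
move=> e0; have r1 : `|ratio| < 1.
  rewrite ger0_norm ?divr_ge0 ?ler0n // ltr_pdivrMr ?ltr0n // mul1r ltr_nat //.
have /cvgrPdist_lt/(_ _ e0)[M _ MP] := cvg_geometric (2 : R) r1.
exists M => m Mm; have := MP _ Mm; rewrite sub0r normrN /geometric /=.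
exact/le_lt_trans/ler_norm.
Qed.

End Mesh.

(** * Lebesgue numbers of open covers of a simplex *)

Section Lebesgue.
Variables (R : realType) (n : nat) (T : topologicalType).
Local Notation Delta n := (@std_simplex R n).

Lemma std_simplex_compact : compact (Delta n : set 'rV[R]_n.+1).
Proof.
apply: bounded_closed_compact.
  exists 1; split=> // M M1 x Dx /=.
  apply: le_trans (ltW M1); exact: (@simplex_norm R n (exist _ x (mem_set Dx))).
have -> : (Delta n : set 'rV[R]_n.+1) =
    (\bigcap_(i in [set: 'I_n.+1]) [set x | 0 <= x 0 i]) `&` [set x | \sum_i x 0 i = 1].
  by apply/seteqP; split=> x /= [x0 x1]; split=> // i; have := x0 i; exact.
apply: closedI.
  apply: closed_bigI => i _.
  by apply: (@closed_comp _ _ (fun x : 'rV[R]_n.+1 => x 0 i) [set y | 0 <= y]);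
    [move=> x _; exact: coord_continuous|exact: closed_ge].
apply: (@closed_comp _ _ (fun x : 'rV[R]_n.+1 => \sum_i x 0 i) [set y | y = 1]).
  move=> x _; apply: (@continuous_big _ _ (+%R : R -> R -> R)).
    exact: add_continuous.
  by move=> i _; exact: coord_continuous.
exact: closed_eq.
Qed.

Lemma lebesgue_number (f : singular_simplex R T n) (D : set (set T)) :
  (forall U, D U -> open U) -> (forall x, exists2 U, D U & U (f x)) ->
  exists2 e : R, 0 < e & forall x : Delta n, exists2 U, D U &
    forall y : Delta n, `|set_val x - set_val y| < e -> U (f y).
Proof.
move=> Dopen Dcov.
pose P (e : R) (x : 'rV[R]_n.+1) := exists2 U, D U &
  forall y : Delta n, `|x - set_val y| < e -> U (f y).
(* In this form compactness turns a radius that works near each point into one that works at all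
   points; the filter at [0^'+] ranges over the radii. *)
have /compact_near_coveringP/(_ R (0^'+) P) := std_simplex_compact.
have cov : forall x, (Delta n : set _) x -> \forall x' \near x & e \near 0^'+, P e x'.
  move=> x Dx; pose xx : Delta n := exist _ x (mem_set Dx).
  have [U DU Ux] := Dcov xx.
  have fU : nbhs xx (f @^-1` U).
    apply: (@cts_fun _ _ f xx); apply: open_nbhs_nbhs; split=> //; exact: Dopen.
  case: fU => O [[W oW <-] Wx WU].
  have /nbhs_ballP[e /= e0 eW] : nbhs x W by apply: open_nbhs_nbhs.
  (* Half of [e] is spent on moving the centre from [x] to [x'], half on the new radius. *)
  exists (ball x (e / 2), [set d | d < e / 2]) => /=.
    split; first by apply: nbhsx_ballx; rewrite divr_gt0.
    by apply: nbhs_right_lt; rewrite divr_gt0.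
  move=> [x' d] /= [xx' de]; exists U => // y x'y; apply: WU; apply: eW.
  rewrite -ball_normE /=; rewrite -ball_normE /= in xx'.
  rewrite (splitr e) -(subrKA x') (le_lt_trans (ler_normD _ _)) // ltrD //.
  exact: lt_trans x'y de.
move=> /(_ _ cov) near_e.
near (0 : R)^'+ => e; exists e => // x.
have /(_ (set_val x)) : (Delta n : set _) `<=` P e by near: e.
by apply; exact: set_valP.
Unshelve. all: by end_near. Qed.

End Lebesgue.

(** * Making covered chains small *)

Section SmallSimplices.
Variables (R : realType) (T : topologicalType) (D : set (set T)).
Hypothesis Dopen : forall U, D U -> open U.
Local Notation sing := (singular_simplex R T).
Local Notation bary n := (@barycenter R n).

Definition small k (sigma : sing k) : Prop := exists2 U, D U & forall x, U (sigma x).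

Definition covered k (sigma : sing k) : Prop := forall x, exists2 U, D U & U (sigma x).

Lemma small_covered k (sigma : sing k) : small sigma -> covered sigma.
Proof. by move=> [U DU Us] x; exists U. Qed.

Lemma realize_supported (Q : forall k, sing k -> Prop) n (sigma : sing n) k c :
  (forall s, Q k (affine_simplex sigma k s)) -> supported (@Q k) (realize sigma k c).
Proof.
move=> Qs; apply: (@supported_lift _ (fun=> True)) => //.
  exact: supported_submodule.
move=> s _; case: ifP => _; first by apply: supportedU; exact: Qs.
exact: (submodule0 (supported_submodule _)).
Qed.

Lemma subdivision_small n (sigma : sing n) : covered sigma ->
  exists M, forall m, (M <= m)%N ->
  supported (@small n)
    (realize sigma n (iter_subdivision (bary n) m (gen (vertices R n)))).
Proof.
move=> /(lebesgue_number Dopen)[e e0 eP]; have [M MP] := mesh_cvg n e0.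
exists M => m /MP me.
apply: (supported_lift _ _ (@iter_subdivision_mesh R n m)).
  exact: supported_submodule.
move=> s [sn sd]; rewrite sn eqxx; apply: supportedU.
(* The first vertex of the affine simplex selects the open set; the mesh bound puts all other points
   within its Lebesgue radius. *)
have [U DU Us] := eP (nth (vertex R ord0) s 0); exists U => // x /=.
apply: Us; apply: le_lt_trans me.
by apply: affine_map_norm => // w ws; apply: sd; rewrite // mem_nth // sn.
Qed.

Lemma subdivision_small_uniform n (r : seq (sing n)) :
  (forall sigma, sigma \in r -> covered sigma) ->
  exists m, forall sigma, sigma \in r ->
  supported (@small n)
    (realize sigma n (iter_subdivision (bary n) m (gen (vertices R n)))).
Proof.
(* Smallness for all large [m], rather than for some [m], allows the maximum to be taken over the
   finitely many simplices. *)
move=> rcov; suff [M MP] : exists M, forall m, (M <= m)%N -> forall sigma, sigma \in r ->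
    supported (@small n)
    (realize sigma n (iter_subdivision (bary n) m (gen (vertices R n)))).
  by exists M; exact: MP.
elim: r rcov => [|tau r IH] rcov; first by exists 0%N.
have [|M MP] := IH; first by move=> sigma sr; apply: rcov; rewrite inE sr orbT.
have [N NP] := subdivision_small (rcov tau (mem_head _ _)).
exists (maxn M N) => m; rewrite geq_max => /andP[Mm Nm] sigma.
by rewrite inE => /orP[/eqP->|]; [exact: NP|exact: MP].
Qed.

Theorem small_chains n (c : chain (sing n.+1)) :
  supported (@covered n.+1) c -> supported (@small n) (sing_boundary _ _ n c) ->
  exists2 b, supported (@covered n.+2) b &
             supported (@small n.+1) (c - sing_boundary _ _ n.+1 b).
Proof.
move=> ccov csmall; have [m mP] := subdivision_small_uniform ccov.
pose iota k := gen (vertices R k).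
pose H k := iter_homotopy (bary k) m.
pose theta k : {linear chain (sing k) -> chain (sing k.+1)} :=
  lin (fun sigma => realize sigma k.+1 (H k (iota k))).
pose sd : {linear chain (sing n.+1) -> chain (sing n.+1)} :=
  lin (fun sigma => realize sigma n.+1 (iter_subdivision (bary n.+1) m (iota n.+1))).
have thetaU k sigma : theta k (gen sigma) = realize sigma k.+1 (H k (iota k)).
  exact: linU.
have thetaP : c - sing_boundary _ _ n.+1 (theta n.+1 c) =
              sd c + theta n (sing_boundary _ _ n c).
  apply: (@chain_linear_eq _ _ (idfun \- (sing_boundary _ _ n.+1 \o theta n.+1))
    (sd \+ (theta n \o sing_boundary _ _ n))) => sigma.
  change (gen sigma - sing_boundary _ _ n.+1 (theta n.+1 (gen sigma)) =
     sd (gen sigma) + theta n (sing_boundary _ _ n (gen sigma))).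
  rewrite thetaU boundary_realize; apply/eqP; rewrite subr_eq -addrA addrC -subr_eq.
  have -> : sd (gen sigma) =
    realize sigma n.+1 (iter_subdivision (bary n.+1) m (iota n.+1)) by exact: linU.
  rewrite -{1}(realize_vertices sigma) -linearB iter_homotopyP linearD.
  rewrite addrC; apply/eqP; congr (_ + _).
  (* What remains compares the homotopy on the faces of the universal simplex with [theta] on the
     faces of [sigma]: naturality under cofaces. *)
  rewrite affine_boundaryU seq_boundaryE size_vertices linear_sum [LHS]linear_sum.
  rewrite sing_boundaryU [RHS]linear_sum; apply: eq_bigr => i _.
  rewrite [H _ (_ *: _)]linearZ [LHS]linearZ [RHS]linearZ; congr (_ *: _).
  rewrite -map_coface_vertices -pushU thetaU realize_face.
  congr (realize _ _ _); apply/esym; apply: push_iter_homotopy.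
  exact: coface_barycenter.
exists (theta n.+1 c).
  apply: (supported_lift _ _ ccov); first exact: supported_submodule.
  by move=> sigma scov; apply: realize_supported => s x; exact: scov.
rewrite thetaP; apply: (submoduleD (supported_submodule _)).
  apply: (@supported_lift _ (fun sigma => sigma \in dom (c : {freeg _ / rat}))) => //.
  exact: supported_submodule.
apply: (supported_lift _ _ csmall); first exact: supported_submodule.
by move=> sigma [U DU Us]; apply: realize_supported => s; exists U => //= x; exact: Us.
Qed.

Lemma covered0_small (sigma : sing 0) : covered sigma -> small sigma.
Proof.
by move=> /(_ (vertex R ord0))[U DU Us]; exists U => // x; rewrite (std_simplex0 x).
Qed.

End SmallSimplices.

(** * Subspaces and components *)

Section Subspace.
Variables (R : realType) (T : topologicalType) (S : set T).
Local Notation sing := (singular_simplex R T).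

Definition inside k (sigma : sing k) : Prop := forall x, S (sigma x).

Lemma include_continuous k (sigma : singular_simplex R S k) :
  continuous (set_val \o sigma).
Proof.
by move=> x; apply: continuous_comp; [exact: cts_fun|exact: initial_continuous].
Qed.

Definition include k (sigma : singular_simplex R S k) : sing k :=
  HB.pack (set_val \o sigma)
    (isContinuous.Build _ _ (set_val \o sigma) (@include_continuous k sigma)).

Lemma include_inj k : injective (@include k).
Proof.
move=> sigma tau /continuousEP st; apply/continuousEP => x.
exact/val_inj/(st x).
Qed.

Lemma include_inside k (sigma : singular_simplex R S k) : inside (include sigma).
Proof. by move=> x; exact: set_valP. Qed.

Lemma insideP k (sigma : sing k) : inside sigma -> exists tau, include tau = sigma.
Proof.
move=> sS; pose f (x : @std_simplex R k) : S := exist _ (sigma x) (mem_set (sS x)).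
have cf : continuous f by apply: continuous_comp_initial; exact: cts_fun.
pose f' : continuousType _ _ := HB.pack f (isContinuous.Build _ _ f cf).
by exists f'; apply/continuousEP.
Qed.

Lemma include_boundary k c :
  sing_boundary R T k (push (@include k.+1) c) =
  push (@include k) (boundary (singular_set R S) k c).
Proof.
apply: (@chain_linear_eq _ _ (sing_boundary R T k \o push (@include k.+1))
  (push (@include k) \o sing_boundary R S k)) => sigma.
change (sing_boundary R T k (push (@include k.+1) (gen sigma)) =
  push (@include k) (sing_boundary R S k (gen sigma))).
rewrite pushU !sing_boundaryU linear_sum; apply: eq_bigr => i _.
rewrite linearZ [push _ _]pushU; congr (_ *: gen _).
exact/continuousEP.
Qed.

(** The slack hypothesis speaks of [S] as a space in its own right; injectivity of [include] on
    chains carries it over to chains of the ambient space. *)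
Lemma acyclic_inside k :
  (forall x : reduced_singular_homology R S k.+1, x = 0) ->
  forall c, supported (@inside k.+1) c -> sing_boundary R T k c = 0 ->
  exists2 b, supported (@inside k.+2) b & sing_boundary R T k.+1 b = c.
Proof.
move=> acyc c cS c0.
have [c' c'E] := push_surj (@insideP k.+1) cS.
have c'0 : boundary (singular_set R S) k c' = 0.
  by apply: (push_inj (@include_inj k)); rewrite -include_boundary c'E c0 linear0.
pose z : cycles (boundary (singular_set R S) k) := Cycle (introT eqP c'0).
have : homology_class (boundary (singular_set R S) k.+1) z = 0 by exact: acyc.
rewrite -(homology_class0 (boundary (singular_set R S) k.+1)
  (boundary (singular_set R S) k)).
move=> /homology_classP; rewrite subr0 => /boundary_predP[b' b'E].
exists (push (@include k.+2) b'); first by apply: push_supported; exact: include_inside.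
by rewrite include_boundary b'E.
Qed.

End Subspace.

Section PathComponents.
Variables (R : realType) (T : topologicalType).
Local Notation sing := (singular_simplex R T).

Definition base_point (sigma : sing 0) : T := sigma (vertex R ord0).

Definition point_simplex (x : T) : sing 0 := cst x.

Lemma base_pointK : cancel base_point point_simplex.
Proof. by move=> sigma; apply/continuousEP => x; rewrite (std_simplex0 x). Qed.

Lemma path_simplex (g : R -> T) : {within `[0, 1], continuous g} ->
  exists2 sigma : sing 1, (forall x, (g @` `[0, 1]) (sigma x)) &
    sing_boundary R T 0 (gen sigma) =
      gen (point_simplex (g 1)) - gen (point_simplex (g 0)).
Proof.
move=> /subspace_continuousP gc.
pose h (t : @std_simplex R 1) : R := set_val t 0 ord_max.
have h01 t : h t \in `[0, 1].
  have /= [t0 t1] := set_valP t; rewrite in_itv /= t0 -t1.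
  by rewrite (bigD1 ord_max) //= lerDl sumr_ge0.
have ch : continuous h.
  move=> t; apply: (@continuous_comp _ _ _ set_val (fun y : 'rV[R]_2 => y 0 ord_max)).
    exact: initial_continuous.
  exact: coord_continuous.
have cgh : continuous (g \o h).
  move=> t U /(gc _ (h01 t)) gU.
  have FF : Filter (nbhs t) := nbhs_filter t.
  by apply: (@filterS _ (nbhs t) FF) (ch t _ gU) => t'; apply; exact: h01.
pose sigma : sing 1 := HB.pack (g \o h) (isContinuous.Build _ _ (g \o h) cgh).
exists sigma => [x|]; first by exists (h x) => //; exact: h01.
rewrite sing_boundaryU big_ord_recl big_ord1 expr0 scale1r expr1 scaleN1r.
congr (gen _ - gen _); apply/continuousEP => x; rewrite (std_simplex0 x).
  congr g; rewrite /h /= mxE; case: unliftP => [j _|//]; by rewrite !ord1 mxE !eqxx.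
congr g; rewrite /h /= mxE; case: unliftP => [j /(congr1 val)|//].
by case: j => -[].
Qed.

(* Being joined by a 1-chain is an equivalence relation, so paths need not be
   concatenated; its classes are open, hence contain whole components. *)
Lemma component_path (S : set T) x y : locally_path_connected R T -> open S -> S x ->
  connected_component S x y -> exists2 b, supported (@inside R T S 1) b &
    sing_boundary R T 0 b = gen (point_simplex y) - gen (point_simplex x).
Proof.
move=> lpc oS Sx.
pose E y := exists2 b, supported (@inside R T S 1) b &
    sing_boundary R T 0 b = gen (point_simplex y) - gen (point_simplex x).
have EW W u v : path_connected R W -> W `<=` S -> W u -> W v -> E u -> E v.
  move=> pW WS Wu Wv [b bS bE]; have [g [cg g0 g1 gW]] := pW _ _ Wu Wv.
  have [sigma sg sE] := path_simplex cg; exists (gen sigma + b).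
    apply: (submoduleD (supported_submodule _)) => //; apply: supportedU => z.
    exact/WS/gW/sg.
  by rewrite linearD sE bE g0 g1 addrA subrK.
have nbhsS (Q : set T) (u : T) : S u ->
    (forall W, path_connected R W -> W `<=` S -> W u -> W `<=` Q) -> nbhs u Q.
  move=> Su QW; have [W [oW Wu WS pW]] := lpc u S (open_nbhs_nbhs (conj oS Su)).
  exact: (filterS (QW _ pW WS Wu)) (open_nbhs_nbhs (conj oW Wu)).
have oE : open (S `&` E).
  rewrite openE => u [Su Eu]; apply: nbhsS => // W pW WS Wu v Wv.
  by split; [exact: WS|exact: (EW W u v)].
have oE' : open (S `&` ~` E).
  rewrite openE => u [Su Eu]; apply: nbhsS => // W pW WS Wu v Wv.
  by split; [exact: WS|move=> Ev; apply: Eu; exact: (EW W v u)].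
have Cx : connected_component S x x by exact: connected_component_refl.
have CS : connected_component S x `<=` S by exact: connected_component_sub.
have Ex : E x.
  by exists 0; rewrite ?linear0 ?subrr //; exact: (submodule0 (supported_submodule _)).
have <- : connected_component S x `&` (S `&` E) = connected_component S x.
  apply: (component_connected (x := x)).
  - by exists x; split.
  - by exists (S `&` E).
  - exists (~` (S `&` ~` E)); first by rewrite closedC.
    apply/seteqP; split=> z [Cz].
      by move=> [Sz Ez]; split=> // -[_].
    move=> nz; split=> //; split; first exact: CS.
    by apply: contrapT => nE; apply: nz; split=> //; exact: CS.
by move=> [_ []].
Qed.

(** Every point is joined to a chosen point of its component, so [c] is homologous to a chain that
    depends only on its image under [push cc], which is 0. *)
Lemma component_exact (S : set T) c : locally_path_connected R T -> open S ->
  supported (@inside R T S 0) c ->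
  push (fun sigma => connected_component S (base_point sigma)) c = 0 ->
  exists2 b, supported (@inside R T S 1) b & sing_boundary R T 0 b = c.
Proof.
move=> lpc oS cS c0.
pose rep (C : set T) : chain (sing 0) :=
  if pselect (C !=set0) is left e then gen (point_simplex (projT1 (cid e))) else 0.
pose cc sigma := connected_component S (base_point sigma).
pose Q c := exists2 b, supported (@inside R T S 1) b &
  sing_boundary R T 0 b = c - lin rep (push cc c).
have : Q c.
  apply: (@supported_ind _ (@inside R T S 0) Q) => //.
    exact: (submodule_exists (sing_boundary R T 0) (idfun \- (lin rep \o push cc))
      (supported_submodule _)).
  move=> sigma sS; have Sx : S (base_point sigma) by exact: sS.
  rewrite /Q pushU linU /rep; case: pselect => [e|[]]; last first.
    by exists (base_point sigma); exact: connected_component_refl.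
  case: cid => /= z ccz; have [b bS bE] := component_path lpc oS Sx ccz.
  exists (- b); last by rewrite linearN bE opprB base_pointK.
  rewrite -sub0r; apply: (submoduleB (supported_submodule _)) => //.
  exact: (submodule0 (supported_submodule _)).
by rewrite /Q c0 linear0 subr0.
Qed.

End PathComponents.

Section Segment.
Variables (R : realType) (T : topologicalType).

Lemma simplex1_component (S : set T) (sigma : singular_simplex R T 1) :
  inside S sigma ->
  connected_component S (base_point (singular_face ord0 sigma)) =
  connected_component S (base_point (singular_face ord_max sigma)).
Proof.
move=> sS.
(* Clamping to the unit interval defines the path on the whole line, where its continuity can be
   proved before restricting. *)
pose c (t : R) : R := Num.max 0 (Num.min t 1).
have c01 t : 0 <= c t <= 1.
  by rewrite /c le_max lexx /= ge_max ler01 ge_min lexx orbT.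
pose v (t : R) : 'rV[R]_2 := (1 - c t) *: delta_mx 0 ord0 + c t *: delta_mx 0 ord_max.
have vD t : v t \in @std_simplex R 1.
  have /andP[c0 c1] := c01 t; rewrite inE; split=> [i|].
    by rewrite !mxE addr_ge0 // mulr_ge0 // ?subr_ge0 // ler0n.
  by rewrite big_ord_recl big_ord1 !mxE /= !(mulr0, mulr1, addr0, add0r) subrK.
pose h (t : R) : @std_simplex R 1 := exist _ (v t) (vD t).
have cc : continuous c.
  move=> t; have cmin : {for t, continuous ((id : R -> R^o) \min cst 1)}.
    by apply: continuous_min; [exact: cvg_id|exact: cst_continuous].
  have cz : {for t, continuous (cst 0 : R -> R^o)} by exact: cst_continuous.
  exact: (continuous_max cz cmin).
have ch : continuous h.
  apply: continuous_comp_initial => t; apply: cvgD; apply: cvgZr_tmp.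
    by apply: cvgB; [exact: cvg_cst|exact: cc].
  exact: cc.
pose B := (sigma \o h) @` `[0, 1].
have Bc : connected B.
  apply: connected_continuous_connected; first exact: segment_connected.
  apply: continuous_subspaceT => t; apply: continuous_comp; first exact: ch.
  exact: cts_fun.
have BS : B `<=` S by move=> _ [t _ <-]; exact: sS.
have c0 : c 0 = 0 by rewrite /c min_l ?ler01 // maxxx.
have c1 : c 1 = 1 by rewrite /c minxx max_r ?ler01.
have B1 : B (base_point (singular_face ord0 sigma)).
  exists 1; first by rewrite /= in_itv /= lexx ler01.
  rewrite /base_point /= coface_vertex; congr (sigma _); apply: val_inj.
  rewrite /= /v c1 subrr scale0r add0r scale1r; congr delta_mx; exact: val_inj.
have B0 : B (base_point (singular_face ord_max sigma)).
  exists 0; first by rewrite /= in_itv /= lexx ler01.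
  rewrite /base_point /= coface_vertex; congr (sigma _); apply: val_inj.
  rewrite /= /v c0 subr0 scale0r addr0 scale1r; congr delta_mx; exact: val_inj.
have := connected_component_max B0 BS Bc B1.
move=> C01; have C10 := connected_component_sym C01.
by apply/seteqP; split=> y; apply: connected_component_trans.
Qed.

End Segment.

(** * The double complex of the family *)

(** Exchanging the variables shows that the sum equals its negative, and 2 is invertible in
    [rat]. *)
Lemma alternating_sum_eq0 (V : lmodType rat) (I : finType) (G : I -> I -> V) :
  (forall v w, v != w -> G w v = - G v w) ->
  \sum_v \sum_(w | w != v) G v w = 0.
Proof.
move=> Galt; set S := LHS; suff : S = - S.
  by move/eqP; rewrite -addr_eq0 -mulr2n -scaler_nat scaler_eq0 => /orP[|/eqP].
rewrite {1}/S (exchange_big_dep xpredT) //= -sumrN; apply: eq_bigr => v _.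
rewrite -sumrN; apply: eq_big => [w|w wv]; first by rewrite eq_sym.
exact: Galt.
Qed.

Section Position.
Variable I : finType.
Implicit Types (A : {set I}) (u v w : I).

(** The exponent of the sign is a cardinality, so that its change under insertion and deletion is a
    count; [position_enum_val] identifies it with the index in the enumeration. *)
Definition position A v : nat := #|[set w in A | (enum_rank w < enum_rank v)%N]|.

Lemma position_setD1 A v w : v \in A ->
  ((enum_rank v < enum_rank w) + position (A :\ v)%SET w)%N = position A w.
Proof.
move=> vA; rewrite /position (cardsD1 v [set x in A | _]) !inE vA /=.
congr (_ + _)%N; apply: eq_card => x; rewrite !inE.
by rewrite andbA.
Qed.

Lemma position_setU1 A u w : u \notin A ->
  position (u |: A) w = ((enum_rank u < enum_rank w) + position A w)%N.
Proof. by move=> uA; rewrite -(position_setD1 w (setU11 u A)) setU1K. Qed.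

Lemma position_min A u : (forall w, w \in A -> (enum_rank u <= enum_rank w)%N) ->
  position A u = 0%N.
Proof.
move=> umin; apply/eqP; rewrite cards_eq0 -finset.subset0; apply/fintype.subsetP => w.
by rewrite !inE => /andP[/umin]; rewrite leqNgt => /negbTE->.
Qed.

End Position.

Section Cells.
Variables (R : realType) (T : topologicalType) (F : {fset set T}).
Local Notation sing := (singular_simplex R T).
Local Notation family := [set` F].
Implicit Types (A : {set F}) (v w : F).

(* Cells of the double complex: q = 0 is the multinerve, and q = q'.+1 consists
   of the singular q'-simplices indexed by a subset of F. *)
Definition cell (q : nat) : choiceType :=
  if q is q'.+1 then (sing q' * {set F})%type else (set T * {set F})%type.

Definition cell_index q : cell q -> {set F} :=
  if q is q'.+1 return cell q -> {set F} then @snd _ _ else @snd _ _.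

Definition component_of A (x : T) : set T :=
  if A == finset.set0 then family_union F else connected_component (family_inter A) x.

Definition drop_index q (v : F) : cell q -> cell q :=
  if q is q'.+1 return cell q -> cell q then fun k => (k.1, k.2 :\ v)%SET
  else fun k => let A := (k.2 :\ v)%SET in
    (if A == finset.set0 then family_union F
     else component_containing (family_inter A) k.1, A).

Lemma cell_index_drop q v (k : cell q) :
  cell_index (drop_index v k) = (cell_index k :\ v)%SET.
Proof. by case: q k. Qed.

(** [p] counts indices, one more than the dimension. For singular cells over the empty index set
    smallness is the only geometric condition, so [p = 0] is the complex of small chains. *)
Definition is_cell p q : cell q -> Prop :=
  if q is q'.+1 return cell q -> Prop then
    fun k => [/\ #|k.2| = p, small family k.1 & forall U, U \in k.2 -> inside (val U) k.1]
  else fun k => multinerve k /\ #|k.2| = p.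

Lemma is_cell_card p q (k : cell q) : is_cell p k -> #|cell_index k| = p.
Proof. by case: q k => [|q] k []. Qed.

Definition dh_cell q (k : cell q) : chain (cell q) :=
  \sum_(v in cell_index k) (-1) ^+ position (cell_index k) v *: gen (drop_index v k).

Definition dh q : {linear chain (cell q) -> chain (cell q)} := lin (@dh_cell q).

Lemma dhU q (k : cell q) : dh q (gen k) = dh_cell k.
Proof. exact: linU. Qed.

Definition index_chain A q : {linear chain (sing q) -> chain (cell q.+1)} :=
  push (fun sigma => (sigma, A) : cell q.+1).

Definition dv_cell q : cell q.+1 -> chain (cell q) :=
  if q is q'.+1 return cell q.+1 -> chain (cell q) then
    fun k => index_chain k.2 q' (sing_boundary R T q' (gen k.1))
  else fun k => gen ((component_of k.2 (base_point k.1), k.2) : cell 0).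

Definition dv q : {linear chain (cell q.+1) -> chain (cell q)} := lin (@dv_cell q).

Lemma dvU q (k : cell q.+1) : dv q (gen k) = dv_cell k.
Proof. exact: linU. Qed.

Lemma dv_index_chain A q c :
  dv q.+1 (index_chain A q.+1 c) = index_chain A q (sing_boundary R T q c).
Proof.
apply: (@chain_linear_eq _ _ (dv q.+1 \o index_chain A q.+1)
  (index_chain A q \o sing_boundary R T q)) => sigma.
change (dv q.+1 (index_chain A q.+1 (gen sigma)) =
  index_chain A q (sing_boundary R T q (gen sigma))).
by rewrite [index_chain A _ (gen sigma)]pushU dvU.
Qed.

Lemma dv_cellE q (sigma : sing q.+1) A :
  dv q.+1 (gen ((sigma, A) : cell q.+2)) =
  \sum_(i < q.+2) (-1) ^+ i *: gen ((singular_face i sigma, A) : cell q.+1).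
Proof.
rewrite dvU /= sing_boundaryU linear_sum; apply: eq_bigr => i _.
by rewrite linearZZ [index_chain _ _ _]pushU.
Qed.

Lemma cell0P p (k : cell 0) : is_cell p.+1 k ->
  exists2 x, family_inter k.2 x & k = (component_of k.2 x, k.2).
Proof.
case: k => C A [/= mCA cA]; have A0 : A != finset.set0 by rewrite -cards_eq0 cA.
move: mCA; rewrite /multinerve /= (negbTE A0) => -[x Ax ->]; exists x => //=.
by rewrite /component_of (negbTE A0).
Qed.

Lemma component_of_cell A x : (A != finset.set0 -> family_inter A x) ->
  is_cell #|A| ((component_of A x, A) : cell 0).
Proof.
move=> Ax; split=> //; rewrite /multinerve /component_of /=.
by case: eqVneq Ax => // A0 /(_ isT) Ax; exists x.
Qed.

Lemma family_interD1 A v : family_inter A `<=` family_inter (A :\ v)%SET.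
Proof. exact/family_interS/subD1set. Qed.

Lemma drop_component_of A x v : v \in A -> family_inter A x ->
  drop_index v ((component_of A x, A) : cell 0) =
  (component_of (A :\ v)%SET x, (A :\ v)%SET).
Proof.
move=> vA Ax; rewrite /= /component_of.
have /negbTE-> : A != finset.set0 by apply/set0Pn; exists v.
by rewrite component_containingE //; exact: family_interD1.
Qed.

Lemma is_cell_drop p q (k : cell q) v : v \in cell_index k -> is_cell p.+1 k ->
  is_cell p (drop_index v k).
Proof.
move=> vk kP; have : #|(cell_index k :\ v)%SET| = p.
  by have := is_cell_card kP; rewrite (cardsD1 v) vk => -[].
case: q k kP vk => [|q] k kP vk cp.
  have [x kx kE] := cell0P kP; rewrite kE drop_component_of // -cp.
  by apply: component_of_cell => _; exact: family_interD1.
by case: kP => _ sk kU; split=> //= U; rewrite inE => /andP[_ /kU].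
Qed.

Lemma drop_indexC p q (k : cell q) v w : is_cell p.+1 k -> v != w ->
  v \in cell_index k -> w \in cell_index k ->
  drop_index w (drop_index v k) = drop_index v (drop_index w k).
Proof.
have DC A : (A :\ v :\ w = A :\ w :\ v)%SET by rewrite !finset.setDDl finset.setUC.
case: q k => [|q] k kP vw vk wk; last by rewrite /= DC.
have [x kx kE] := cell0P kP; rewrite kE !drop_component_of ?DC //.
- by rewrite !inE vw.
- exact: family_interD1.
- by rewrite !inE eq_sym vw.
- exact: family_interD1.
Qed.

Local Notation isc p q := (supported (@is_cell p q)).

Lemma dh_supported p q c : isc p.+1 q c -> isc p q (dh q c).
Proof.
apply: (@supported_lift _ (@is_cell p.+1 q) _ (isc p q)).
  exact: supported_submodule.
move=> k kP; apply: (submodule_sum (supported_submodule _)) => v vk.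
apply: (submoduleZ (supported_submodule _)); apply: supportedU; exact: is_cell_drop.
Qed.

Lemma dv_supported p q c : isc p q.+1 c -> isc p q (dv q c).
Proof.
apply: (@supported_lift _ (@is_cell p q.+1) _ (isc p q)).
  exact: supported_submodule.
case: q {c} => [|q] [sigma A] [/= cA [U FU Us] As].
  apply: supportedU; rewrite -cA; apply: component_of_cell => _ V VA; exact: As.
rewrite -[X in isc p q.+1 X]/(dv_cell ((sigma, A) : cell q.+2)) -dvU dv_cellE.
apply: (submodule_sum (supported_submodule _)) => i _.
apply: (submoduleZ (supported_submodule _)); apply: supportedU; split=> //=.
  by exists U => // x; exact: Us.
by move=> V VA x; exact: As.
Qed.

Lemma dh_dh p q c : isc p.+2 q c -> dh q (dh q c) = 0.
Proof.
apply: (@supported_eq _ (@is_cell p.+2 q) _ (dh q \o dh q) \0) => k kP.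
change (dh q (dh q (gen k)) = 0); rewrite dhU linear_sum.
set A := cell_index k.
pose G v w : chain (cell q) := if (v \in A) && (w \in A) then
  (-1) ^+ (position A v + position (A :\ v)%SET w) *:
    gen (drop_index w (drop_index v k)) else 0.
rewrite -[RHS](@alternating_sum_eq0 _ _ G) => [|v w vw].
  rewrite big_mkcond /=; apply: eq_bigr => v _; rewrite /G; case: ifP => vA.
    rewrite linearZZ dhU /dh_cell cell_index_drop -/A scaler_sumr.
    rewrite big_mkcond [RHS]big_mkcond; apply: eq_bigr => w _.
    by rewrite !inE; case: eqP => //= _; case: ifP => // _; rewrite scalerA exprD.
  by rewrite big1.
rewrite /G andbC; case: ifP => [/andP[vA wA]|_]; last by rewrite oppr0.
rewrite (drop_indexC kP vw vA wA) -scaleNr; congr (_ *: _).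
(* Both exponents contain the positions taken after the other index is removed; they differ by one,
   as exactly one of [v], [w] precedes the other. *)
rewrite -(position_setD1 w vA) -(position_setD1 v wA).
have : enum_rank v != enum_rank w by rewrite (inj_eq enum_rank_inj).
rewrite -val_eqE /= neq_ltn -signr_odd -[in RHS]signr_odd !oddD => /orP[] lt.
  by rewrite lt ltnNge ltnW //=; do 2!case: odd; rewrite ?expr0 ?expr1 ?opprK.
by rewrite lt ltnNge ltnW //=; do 2!case: odd; rewrite ?expr0 ?expr1 ?opprK.
Qed.

Lemma dv_dv p q c : isc p q.+2 c -> dv q (dv q.+1 c) = 0.
Proof.
apply: (@supported_eq _ (@is_cell p q.+2) _ (dv q \o dv q.+1) \0) => -[sigma A] kP {c}.
change (dv q (dv q.+1 (gen ((sigma, A) : cell q.+2))) = 0).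
case: q sigma kP => [|q] sigma kP; last first.
  (* The square of the singular differential vanishes because [sigma] realizes the universal affine
     simplex. *)
  rewrite dvU /dv_cell dv_index_chain -[gen sigma]realize_vertices /=.
  by rewrite boundary_realize boundary_realize boundary_boundary !linear0.
(* At the bottom both endpoints of the 1-simplex name the same component, or both name the union. *)
rewrite dv_cellE big_ord_recl big_ord1 expr0 scale1r expr1 scaleN1r linearB.
rewrite !dvU /= /component_of; case: ifP => A0; first by rewrite subrr.
rewrite (@simplex1_component _ _ (family_inter A) sigma).
  by rewrite (_ : ord_max = fintype.lift ord0 ord0) ?subrr //; exact: val_inj.
by case: kP => /= _ _ sA x U UA; exact: sA.
Qed.

Lemma dh_dv p q c : isc p.+1 q.+1 c -> dh q (dv q c) = dv q (dh q.+1 c).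
Proof.
apply: (@supported_eq _ (@is_cell p.+1 q.+1) _ (dh q \o dv q) (dv q \o dh q.+1)).
move=> -[sigma A] kP {c}.
change (dh q (dv q (gen ((sigma, A) : cell q.+1))) =
  dv q (dh q.+1 (gen ((sigma, A) : cell q.+1)))).
case: q sigma kP => [|q] sigma kP.
  rewrite dvU /dv_cell !dhU linear_sum; apply: eq_bigr => v vA.
  rewrite linearZZ dvU drop_component_of //; case: kP => /= _ _ sA U UA; exact: sA.
rewrite dv_cellE dhU !linear_sum.
under eq_bigr do rewrite linearZZ dhU /dh_cell scaler_sumr.
under [RHS]eq_bigr do rewrite linearZZ dv_cellE scaler_sumr.
rewrite exchange_big; apply: eq_bigr => v vA; apply: eq_bigr => i _.
by rewrite !scalerA mulrC.
Qed.

Lemma cells_double_complex :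
  @double_complex (fun _ q => chain (cell q)) (fun _ => dh) (fun _ => dv)
    (fun p q => isc p q).
Proof.
split=> p q; first exact: supported_submodule.
- exact: dh_supported.
- exact: dv_supported.
- exact: dh_dh.
- exact: dv_dv.
- exact: dh_dv.
Qed.

End Cells.

(** * Exactness of the rows *)

Section RowsExact.
Variables (R : realType) (T : topologicalType) (F : {fset set T}).
Local Notation sing := (singular_simplex R T).
Local Notation family := [set` F].
Local Notation cell := (cell R F).
Local Notation isc p q := (supported (@is_cell R T F p q)).

(* Coning with the first member of F that contains the simplex keeps the cone
   point in position 0, so that no sign appears. *)
Definition first_member q (sigma : sing q) : option F :=
  [pick u : F | `[< inside (val u) sigma >] &&
    [forall w : F, `[< inside (val w) sigma >] ==> (enum_rank u <= enum_rank w)%N]].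

Lemma first_memberP q (sigma : sing q) : small family sigma ->
  exists u, [/\ first_member sigma = Some u, inside (val u) sigma &
    forall w : F, inside (val w) sigma -> (enum_rank u <= enum_rank w)%N].
Proof.
move=> [U FU sU]; rewrite /first_member.
case: pickP => [u /andP[/asboolP su /forallP um]|none].
  by exists u; split=> // w sw; apply: (implyP (um w)); exact/asboolP.
pose u0 : F := [` FU]%fset.
pose P (u : F) := `[< inside (val u) sigma >].
have u0P : P u0 by apply/asboolP => x; exact: sU.
have [u su um] := @arg_minnP _ u0 P (fun u : F => enum_rank u : nat) u0P.
have := none u; rewrite -/(P u) su /= => /forallP[] w; apply/implyP; exact: um.
Qed.

Definition cone_cell q (k : cell q.+1) : chain (cell q.+1) :=
  if first_member k.1 is Some u then
    if u \in k.2 then 0 else gen ((k.1, (u |: k.2)%SET) : cell q.+1)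
  else 0.

Definition cone_index q : {linear chain (cell q.+1) -> chain (cell q.+1)} :=
  lin (@cone_cell q).

Lemma cone_indexU q k : cone_index q (gen k) = cone_cell k.
Proof. exact: linU. Qed.

Lemma cone_index_supported p q c : isc p q.+1 c -> isc p.+1 q.+1 (cone_index q c).
Proof.
apply: (@supported_lift _ (@is_cell R T F p q.+1) _ (isc p.+1 q.+1)).
  exact: supported_submodule.
move=> [sigma A] [/= cA ss sA]; rewrite /cone_cell /=.
have [u [-> su _]] := first_memberP ss; case: ifPn => uA.
  exact: (submodule0 (supported_submodule _)).
apply: supportedU; split=> //=; first by rewrite cardsU1 uA cA.
by move=> U; rewrite !inE => /orP[/eqP->|/sA].
Qed.

(** For fixed [sigma] the row is the augmented chain complex of the full simplex on the members
    containing [sigma]; coning from its first vertex contracts it. *)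
Lemma cone_indexP p q c : isc p q.+1 c ->
  dh R F q.+1 (cone_index q c) + cone_index q (dh R F q.+1 c) = c.
Proof.
apply: (@supported_eq _ (@is_cell R T F p q.+1) _
  ((dh R F q.+1 \o cone_index q) \+ (cone_index q \o dh R F q.+1)) idfun).
move=> [sigma A] [/= _ ss sA] {c}.
change (dh R F q.+1 (cone_index q (gen ((sigma, A) : cell q.+1))) +
  cone_index q (dh R F q.+1 (gen ((sigma, A) : cell q.+1))) =
  gen ((sigma, A) : cell q.+1)).
have [u [uE su um]] := first_memberP ss.
have cE B : cone_index q (gen ((sigma, B) : cell q.+1)) =
    if u \in B then 0 else gen ((sigma, (u |: B)%SET) : cell q.+1).
  by rewrite cone_indexU /cone_cell /= uE.
rewrite cE dhU linear_sum; case: ifPn => uA.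
  rewrite linear0 add0r (bigD1 u) //= big1 => [|v /andP[vA vu]].
    rewrite linearZZ cE !inE eqxx /= finset.setD1K // position_min.
      by rewrite expr0 scale1r addr0.
    by move=> w wA; apply/um/sA.
  by rewrite linearZZ cE !inE eq_sym vu uA scaler0.
rewrite dhU /dh_cell /= (bigD1 u) ?setU11 //= setU1K //.
rewrite (position_min (A := (u |: A)%SET)); last first.
  by move=> w; rewrite !inE => /orP[/eqP->//|wA]; exact/um/sA.
rewrite expr0 scale1r -addrA [X in _ + X](_ : _ = 0) ?addr0 //.
rewrite (eq_bigl (fun v => v \in A)); last first.
  move=> v; rewrite !inE; case: eqP => [->|_] /=; first by rewrite (negbTE uA).
  by rewrite andbT.
rewrite -big_split big1 // => v vA; rewrite linearZZ cE.
have vu : u != v by apply: contraNneq uA => ->.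
rewrite !inE (negbTE uA) andbF.
have -> : ((u |: A) :\ v = u |: A :\ v)%SET.
  by apply/setP => w; rewrite !inE; case: eqP => // ->; rewrite eq_sym (negbTE vu).
(* As [u] comes before [v], inserting [u] raises the position of [v] by one, and the two terms
   cancel. *)
rewrite position_setU1 // (_ : (enum_rank u < enum_rank v)%N) /=.
  by rewrite exprS mulN1r scaleNr addNr.
rewrite ltn_neqAle um ?andbT; last exact: sA.
by rewrite (inj_eq val_inj) (inj_eq enum_rank_inj).
Qed.

Lemma cells_rows_exact k :
  rows_exact (V := fun _ q => chain (cell q)) (fun _ => dh R F) (fun p q => isc p q) k.
Proof.
split=> [u Pu|p q u _ Pu du].
  exists (cone_index k u); first exact: cone_index_supported.
  rewrite -[RHS](cone_indexP Pu) (_ : dh R F k.+1 u = 0) ?linear0 ?addr0 //.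
  apply: (@supported_eq _ (@is_cell R T F 0 k.+1) _ (dh R F k.+1) \0) => //.
  move=> [sigma A] [/= A0 _ _].
  change (dh R F k.+1 (gen ((sigma, A) : cell k.+1)) = 0).
  by rewrite dhU /dh_cell /= (cards0_eq A0) big_set0.
exists (cone_index q u); first exact: cone_index_supported.
by rewrite -[RHS](cone_indexP Pu) du linear0 addr0.
Qed.

End RowsExact.

(** * Exactness of the columns *)

Section ColumnsExact.
Variables (R : realType) (T : topologicalType) (F : {fset set T}).
Local Notation sing := (singular_simplex R T).
Local Notation family := [set` F].
Local Notation cell := (cell R F).
Local Notation isc p q := (supported (@is_cell R T F p q)).
Local Notation index_chain := (index_chain R).
Implicit Types A : {set F}.

Definition slice A q : {linear chain (cell q.+1) -> chain (sing q)} :=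
  lin (fun k : cell q.+1 => if k.2 == A then gen k.1 else 0).

Definition slice0 A : {linear chain (cell 0) -> chain (set T)} :=
  lin (fun k : cell 0 => if k.2 == A then gen k.1 else 0).

Lemma sliceU A q sigma B : slice A q (gen ((sigma, B) : cell q.+1)) =
  if B == A then gen sigma else 0.
Proof. exact: linU. Qed.

(** A column splits as a direct sum over index sets: [slice] is the projection to a summand and
    [index_chain] its inclusion. *)
Lemma slice_sum q c : c = \sum_A index_chain A q (slice A q c).
Proof.
pose f : {linear chain (cell q.+1) -> chain (cell q.+1)} :=
  lin (fun k => \sum_A index_chain A q (slice A q (gen k))).
have fE : f c = \sum_A index_chain A q (slice A q c).
  apply: (@supported_ind _ (fun=> True)
    (fun c => f c = \sum_A index_chain A q (slice A q c))) => //.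
    split=> [|a u v fu fv].
      by rewrite linear0 big1 // => A _; rewrite !linear0.
    rewrite linearP fu fv scaler_sumr -big_split; apply: eq_bigr => A _ /=.
    by rewrite !linearP.
  by move=> k _; exact: linU.
rewrite -fE; apply: (@chain_linear_eq _ _ idfun f) => -[sigma A].
rewrite [RHS]linU (bigD1 A) //= big1 => [|B BA].
  by rewrite sliceU eqxx [index_chain _ _ _]pushU addr0.
by rewrite sliceU eq_sym (negbTE BA) linear0.
Qed.

Lemma slice_dv A q c : slice A q (dv R F q.+1 c) = sing_boundary R T q (slice A q.+1 c).
Proof.
apply: (@chain_linear_eq _ _ (slice A q \o dv R F q.+1)
  (sing_boundary R T q \o slice A q.+1)).
move=> [sigma B].
change (slice A q (dv R F q.+1 (gen ((sigma, B) : cell q.+2))) =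
  sing_boundary R T q (slice A q.+1 (gen ((sigma, B) : cell q.+2)))).
rewrite dv_cellE linear_sum sliceU; case: ifP => BA.
  by rewrite sing_boundaryU; apply: eq_bigr => i _; rewrite linearZZ sliceU BA.
by rewrite linear0 big1 // => i _; rewrite linearZZ sliceU BA scaler0.
Qed.

Lemma slice0_dv A c : A != finset.set0 ->
  slice0 A (dv R F 0 c) =
  push (fun sigma => connected_component (family_inter A) (base_point sigma))
    (slice A 0 c).
Proof.
move=> A0; set f := push _.
apply: (@chain_linear_eq _ _ (slice0 A \o dv R F 0) (f \o slice A 0)) => -[sigma B].
change (slice0 A (dv R F 0 (gen ((sigma, B) : cell 1))) =
  f (slice A 0 (gen ((sigma, B) : cell 1)))).
rewrite dvU sliceU [LHS]linU /=; case: eqP => [->|_]; last by rewrite linear0.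
by rewrite /f pushU /component_of (negbTE A0).
Qed.

Lemma slice_inside p q A c : isc p q.+1 c ->
  supported (inside (family_inter A) (k := q)) (slice A q c).
Proof.
apply: (@supported_lift _ (@is_cell R T F p q.+1) _ (supported _)).
  exact: supported_submodule.
move=> [sigma B] [/= _ _ sB]; case: eqP => [<-|_].
  by apply: supportedU => x U UB; exact: sB.
exact: (submodule0 (supported_submodule _)).
Qed.

Lemma slice_small p q A c : isc p q.+1 c ->
  supported (small family (k := q)) (slice A q c).
Proof.
apply: (@supported_lift _ (@is_cell R T F p q.+1) _ (supported _)).
  exact: supported_submodule.
move=> [sigma B] [/= _ sB _]; case: eqP => _; first exact: supportedU.
exact: (submodule0 (supported_submodule _)).
Qed.

Lemma slice_card p q A c : isc p q.+1 c -> #|A| <> p -> slice A q c = 0.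
Proof.
move=> cP Ap; apply: (@supported_eq _ (@is_cell R T F p q.+1) _ (slice A q) \0) => //.
move=> [sigma B] [/= cB _ _]; rewrite sliceU; case: eqP => // BA.
by rewrite -BA in Ap.
Qed.

Lemma index_chain_supported p q A c : #|A| = p.+1 ->
  supported (inside (family_inter A) (k := q)) c -> isc p.+1 q.+1 (index_chain A q c).
Proof.
move=> cA; apply: (@supported_lift _ _ _ (isc p.+1 q.+1)).
  exact: supported_submodule.
move=> sigma sA; apply: supportedU; split=> //= [|U UA x]; last exact: sA.
have /set0Pn[U UA] : A != finset.set0 by rewrite -cards_eq0 cA.
by exists (val U) => [|x]; [exact: (valP U)|exact: sA].
Qed.

Lemma family_inter_open A : (forall U, U \in F -> open U) -> open (family_inter A).
Proof.
move=> hopen; rewrite openE => x Ax.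
have FF : Filter (nbhs x) := nbhs_filter x.
have : \forall y \near x, forall U : F, U \in A -> (val U) y.
  apply: (filter_forall FF) => U; case: (boolP (U \in A)) => UA.
    have := open_nbhs_nbhs (conj (hopen _ (valP U)) (Ax U UA)).
    by apply: filterS => y Uy _.
  by apply: (filterS _ (@filterT _ (nbhs x) FF)) => y _ UA'; case/negP: UA.
by apply: filterS => y yU U /= UA; exact: yU.
Qed.

(** For simplices of dimension [q] over [p.+1] members the slack condition [s - #|A| <= q] reads
    [s <= p + q.+1 = k]. Dimension 0 is out of its range and is handled by components; the bottom is
    reached by choosing a point in each component. *)
Lemma cells_columns_exact (s : int) k :
  locally_path_connected R T -> (forall U : set T, U \in F -> open U) ->
  acyclic_with_slack R F s -> s <= k%:Z ->
  columns_exact (V := fun _ q => chain (cell q)) (fun _ => dv R F) (fun p q => isc p q) k.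
Proof.
move=> lpc hopen acyc sk; split=> [u Pu|p q u pqk Pu du].
  apply: (@supported_ind _ (@is_cell R T F k.+1 0)
    (fun u => exists2 v, isc k.+1 1 v & dv R F 0 v = u)) => //.
    exact: (submodule_exists (dv R F 0) idfun (supported_submodule _)).
  move=> c cP; have [x cx ->] := cell0P cP; have cA := is_cell_card cP.
  exists (index_chain c.2 0 (gen (point_simplex R x))).
    by apply: index_chain_supported => //; apply: supportedU => y.
  by rewrite [index_chain _ _ _]pushU dvU.
have ex A : exists2 b, supported (inside (family_inter A) (k := q.+1)) b &
    sing_boundary R T q b = slice A q u.
  case: (eqVneq #|A| p.+1) => cA; last first.
    exists 0; first exact: (submodule0 (supported_submodule _)).
    by rewrite linear0 (slice_card Pu) //; exact/eqP.
  have A0 : A != finset.set0 by rewrite -cards_eq0 cA.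
  have uA := slice_inside (A := A) Pu.
  case: q u pqk Pu du uA => [|q] u pqk Pu du uA.
    apply: component_exact => //; first exact: family_inter_open.
    by rewrite -slice0_dv // du linear0.
  apply: acyclic_inside => //; last by rewrite -slice_dv du linear0.
  apply: acyc => //; rewrite ge_max cA; lia.
pose b A := projT1 (cid2 (ex A)).
have bA A : supported (inside (family_inter A) (k := q.+1)) (b A).
  by rewrite /b; case: cid2.
have bE A : sing_boundary R T q (b A) = slice A q u by rewrite /b; case: cid2.
exists (\sum_(A : {set F} | #|A| == p.+1) index_chain A q.+1 (b A)).
  apply: (submodule_sum (supported_submodule _)) => A /eqP cA.
  exact: index_chain_supported.
rewrite linear_sum [RHS]slice_sum big_mkcond; apply: eq_bigr => A _.
case: eqP => cA; first by rewrite dv_index_chain bE.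
by rewrite (slice_card Pu) // linear0.
Qed.

End ColumnsExact.

(** * Signs by counting and signs by enumeration *)

Section EnumPosition.
Variable I : finType.
Implicit Type A : {set I}.

Lemma enum_rank_sorted A : sorted ltn [seq val (enum_rank x) | x <- enum A].
Proof.
have sortedI : sorted (relpre (fun x : I => val (enum_rank x)) ltn) (enum I).
  rewrite -sorted_map (_ : map _ _ = iota 0 #|I|); first exact: iota_ltn_sorted.
  apply: (@eq_from_nth _ 0%N) => [|i]; rewrite size_map -cardE ?size_iota // => iI.
  rewrite nth_iota // add0n; have x0 : I by case: (enum I) (cardE I) iI => [->|].
  rewrite (nth_map x0) -?cardE //.
  have -> : nth x0 (enum I) i = enum_val (Ordinal iI) by rewrite (enum_val_nth x0).
  by rewrite enum_valK.
rewrite sorted_map; rewrite enumT in sortedI; apply: sorted_filter sortedI.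
by move=> y x z /=; exact: ltn_trans.
Qed.

(** This reconciles the signs of [dh] with those of [boundary], where faces are numbered along
    [enum A]. That list increases in [enum_rank], so the members ranked below the [i]-th are those
    of smaller index. *)
Lemma position_enum_val A (i : 'I_#|A|) : position A (enum_val i) = i.
Proof.
have x0 : I := enum_val i.
have rank_lt (j k : 'I_#|A|) :
    (enum_rank (enum_val j) < enum_rank (enum_val k))%N = (j < k)%N.
  have mono := @sorted_ltn_nth _ ltn ltn_trans 0%N _ (enum_rank_sorted A).
  have nthE (l : 'I_#|A|) :
      nth 0%N [seq val (enum_rank x) | x <- enum A] l = enum_rank (enum_val l).
    by rewrite (nth_map x0) -?cardE // (enum_val_nth x0).
  have lA (l : 'I_#|A|) : (l : nat) \in
      [pred n | (n < size [seq val (enum_rank x) | x <- enum A])%N].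
    by rewrite inE size_map -cardE.
  case: (ltngtP j k) => jk.
  - by have := mono _ _ (lA j) (lA k) jk; rewrite !nthE.
  - have := mono _ _ (lA k) (lA j) jk.
    by rewrite !nthE => /ltnW; rewrite leqNgt => /negbTE.
  - by rewrite (val_inj jk) ltnn.
rewrite /position -sum1_card.
transitivity (\sum_(w in A | (enum_rank w < enum_rank (enum_val i))%N) 1)%N.
  by apply: eq_bigl => w; rewrite inE.
rewrite big_mkcondr big_enum_val /=.
under eq_bigr do rewrite rank_lt.
rewrite -big_mkcond (big_ord_narrow (ltnW (ltn_ord i))).
by rewrite sum1_card card_ord.
Qed.

End EnumPosition.

(** * The multinerve as an edge of the double complex *)

Section MultinerveCells.
Variables (R : realType) (T : topologicalType) (F : {fset set T}).
Local Notation cell := (cell R F).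
Local Notation isc p q := (supported (@is_cell R T F p q)).
Local Notation M := (multinerve_set F).

Definition embed n (p : multinerve_simplex F n) : cell 0 := val p.

Lemma embed_inj n : injective (@embed n).
Proof. exact: val_inj. Qed.

Lemma embed_is_cell n (p : multinerve_simplex F n) : is_cell n.+1 (embed p).
Proof. by have /andP[/asboolP pm /eqP pn] := valP p. Qed.

Lemma is_cell_embed n (k : cell 0) : is_cell n.+1 k ->
  exists p : multinerve_simplex F n, embed p = k.
Proof.
move=> [km kn]; have kP : `[< multinerve k >] && (#|k.2| == n.+1).
  by rewrite kn eqxx andbT; apply/asboolP.
by exists (exist _ k kP).
Qed.

Lemma dh_embed n c : dh R F 0 (push (@embed n.+1) c) = push (@embed n) (boundary M n c).
Proof.
apply: (@chain_linear_eq _ _ (dh R F 0 \o push (@embed n.+1))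
  (push (@embed n) \o boundary M n)) => p.
change (dh R F 0 (push (@embed n.+1) (gen p)) =
  push (@embed n) (boundary M n (gen p))).
have -> : boundary M n (gen p) = \sum_(i < n.+2) (-1) ^+ i *: gen (multinerve_face i p).
  exact: linU.
rewrite pushU dhU /dh_cell linear_sum; set A := cell_index _.
pose cA : #|A| = n.+2 := multinerve_simplex_card p.
rewrite big_enum_val (reindex (cast_ord (esym cA))) /=; last first.
  by exists (cast_ord cA) => i _; [exact: cast_ordKV|exact: cast_ordK].
apply: eq_bigr => i _; rewrite position_enum_val linearZZ [push _ _]pushU /=.
congr (_ *: gen _).
have /negbTE D0 : (A :\ enum_val (cast_ord (esym cA) i))%SET != finset.set0.
  by rewrite -cards_eq0; have -> := multinerve_simplex_card (multinerve_face i p).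
by rewrite D0.
Qed.

(** The corner of the double complex has the least element of the multinerve as its only generator,
    so [dh] ends in the augmentation. *)
Lemma dh_embed0 c : dh R F 0 (push (@embed 0) c) =
  (augmentation M c : rat) *: gen ((family_union F, finset.set0) : cell 0).
Proof.
set X := gen _.
have augU p : augmentation M (gen p) = 1 by exact: linU.
apply: (@supported_ind _ (fun=> True)
  (fun c => dh R F 0 (push (@embed 0) c) = (augmentation M c : rat) *: X)) => //.
  split=> [|a u v hu hv]; first by rewrite !linear0 scale0r.
  by rewrite !linearP hu hv scalerDl -scalerA.
move=> p _; rewrite augU scale1r pushU dhU /dh_cell.
have /eqP/cards1P[v pv] := multinerve_simplex_card p.
rewrite (_ : cell_index (embed p) = [set v]%SET) // big_set1 position_min; last first.
  by move=> w; rewrite inE => /eqP->.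
rewrite expr0 scale1r; congr gen; rewrite /= pv.
by rewrite finset.setDv eqxx.
Qed.

End MultinerveCells.

(** * Comparison of the two homologies *)

Section Comparison.
Variables (R : realType) (T : topologicalType) (F : {fset set T}).
Local Notation sing := (singular_simplex R T).
Local Notation family := [set` F].
Local Notation X := (family_union F).
Local Notation cell := (cell R F).
Local Notation isc p q := (supported (@is_cell R T F p q)).
Local Notation M := (multinerve_set F).
Local Notation S := (singular_set R X).
Local Notation incl k := (push (@include R T X k)).
Local Notation idx0 := (index_chain R (finset.set0 : {set F})).
Local Notation emb k := (push (@embed R T F k)).
Local Notation zz := (@zigzag (fun _ q => chain (cell q))
  (fun _ => dh R F) (fun _ => dv R F) (fun p q => isc p q)).

Lemma sing_boundary_boundary k c : sing_boundary R T k (sing_boundary R T k.+1 c) = 0.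
Proof.
apply: (@chain_linear_eq _ _ (sing_boundary R T k \o sing_boundary R T k.+1) \0) => sigma.
change (sing_boundary R T k (sing_boundary R T k.+1 (gen sigma)) = 0).
by rewrite -realize_vertices !boundary_realize boundary_boundary linear0.
Qed.

Lemma idx0_inj k : injective (idx0 k).
Proof. by apply: push_inj => sigma tau []. Qed.

Lemma idx0_supported k c : supported (small family (k := k)) c -> isc 0 k.+1 (idx0 k c).
Proof.
apply: (@supported_lift _ _ _ (isc 0 k.+1)); first exact: supported_submodule.
move=> sigma ss; apply: supportedU; split=> //=; first exact: cards0.
by move=> U; rewrite inE.
Qed.

Lemma idx0_surj k x : isc 0 k.+1 x ->
  exists2 c, supported (small family (k := k)) c & idx0 k c = x.
Proof.
move=> xP; exists (slice R finset.set0 k x); first exact: slice_small xP.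
rewrite [RHS]slice_sum (bigD1 finset.set0) //= [X in _ + X]big1 ?addr0 // => A A0.
by rewrite (slice_card xP) ?linear0 //; apply/eqP; rewrite cards_eq0.
Qed.

Lemma incl_surj k c : supported (covered family (k := k)) c -> exists c', incl k c' = c.
Proof. exact: (push_surj (@insideP R T X k)). Qed.

Lemma incl_covered k c : supported (covered family (k := k)) (incl k c).
Proof. by apply: push_supported => sigma x; exact: (include_inside sigma x). Qed.

Lemma incl_inj k : injective (incl k).
Proof. exact/push_inj/include_inj. Qed.

Lemma emb_inj k : injective (emb k).
Proof. exact/push_inj/embed_inj. Qed.

Lemma dv_idx0_incl c : dv R F 0 (idx0 0 (incl 0 c)) =
  (augmentation S c : rat) *: gen ((X, finset.set0) : cell 0).
Proof.
set x := gen _.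
have augU p : augmentation S (gen p) = 1 by exact: linU.
apply: (@supported_ind _ (fun=> True)
  (fun c => dv R F 0 (idx0 0 (incl 0 c)) = (augmentation S c : rat) *: x)) => //.
  split=> [|a u v hu hv]; first by rewrite !linear0 scale0r.
  by rewrite !linearP hu hv scalerDl -scalerA.
move=> p _; rewrite augU scale1r pushU [idx0 0 _]pushU dvU.
by rewrite /dv_cell /component_of eqxx.
Qed.

Lemma dv_idx0_boundary k c : dv R F k (idx0 k (sing_boundary R T k c)) = 0.
Proof.
case: k c => [|k] c; last by rewrite dv_index_chain sing_boundary_boundary linear0.
apply: (@chain_linear_eq _ _ (dv R F 0 \o (idx0 0 \o sing_boundary R T 0)) \0) => sigma.
change (dv R F 0 (idx0 0 (sing_boundary R T 0 (gen sigma))) = 0).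
rewrite sing_boundaryU big_ord_recl big_ord1 expr0 scale1r expr1 scaleN1r !linearB.
by rewrite ![idx0 0 _]pushU !dvU /dv_cell /component_of eqxx subrr.
Qed.

(** In degree 0 a simplex is a point and covered chains are small already; above that,
    [small_chains] applies to a chain with zero boundary. *)
Lemma small_cycle k c : (forall U, U \in F -> open U) ->
  supported (covered family (k := k)) c -> dv R F k (idx0 k c) = 0 ->
  exists2 w, supported (covered family (k := k.+1)) w &
    supported (small family (k := k)) (c - sing_boundary R T k w).
Proof.
move=> hopen; case: k c => [|k] c ccov dc.
  exists 0; first exact: (submodule0 (supported_submodule _)).
  by rewrite linear0 subr0; apply: supported_sub ccov; exact: covered0_small.
apply: small_chains => //.
have -> : sing_boundary R T k c = 0.
  by apply: (@idx0_inj k); rewrite -dv_index_chain dc linear0.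
exact: (submodule0 (supported_submodule _)).
Qed.

Variables (s : int) (l : nat).
Hypotheses (hT : locally_path_connected R T)
  (hopen : forall U : set T, U \in F -> open U)
  (hacyclic : acyclic_with_slack R F s) (hl : s <= l%:Z).

Let dc := cells_double_complex R F.
Let rows k := @cells_rows_exact R T F k.
Let cols := cells_columns_exact hT hopen hacyclic hl.
Let cols' : columns_exact (V := fun _ q => chain (cell q)) (fun _ => dv R F)
  (fun p q => isc p q) l.+1.
Proof.
apply: cells_columns_exact hacyclic _ => //.
by apply: le_trans hl _; rewrite lez_nat.
Qed.

(** Zigzags start from small chains, while [b] is any chain of the union; subtracting the boundary
    of [w] moves [b] to a small chain in its homology class. *)
Let Rel (a : chains M l) (b : chains S l) : Prop :=
  exists w z, supported (covered family (k := l.+1)) w /\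
    zz (idx0 l (incl l b - sing_boundary R T l w)) (emb l a) z.

Let Rel_linear k u v u' v' : Rel u u' -> Rel v v' -> Rel (k *: u + v) (k *: u' + v').
Proof.
move=> [w [z [wc zz1]]] [w' [z' [wc' zz2]]].
exists (k *: w + w'), (fun i j => k *: z i j + z' i j); split.
  apply: (submoduleD (supported_submodule _)) => //.
  exact: (submoduleZ (supported_submodule _)).
suff <- : idx0 l (k *: (incl l u' - sing_boundary R T l w) +
      (incl l v' - sing_boundary R T l w')) =
    idx0 l (incl l (k *: u' + v') - sing_boundary R T l (k *: w + w')).
  by have := zigzagP k zz1 zz2 dc; rewrite -!linearP.
congr (idx0 l _); rewrite [incl l (_ + _)]linearP.
by rewrite [sing_boundary _ _ _ (_ + _)]linearP scalerBr opprD addrACA.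
Qed.

Let Rel_left (C C' : lmodType rat) (g : {linear chains M l -> C})
    (g' : {linear chains S l -> C'}) :
  (forall a, g a = 0 -> dh R F 0 (emb l a) = 0) ->
  (forall b, dv R F l (idx0 l (incl l b)) = 0 -> g' b = 0) ->
  forall a, g a = 0 -> exists2 b, g' b = 0 & Rel a b.
Proof.
move=> gP g'P a /gP da.
have aP : isc l.+1 0 (emb l a) by apply: push_supported; exact: embed_is_cell.
have [x [z [zzx xP dx]]] := zigzag_exists_bottom dc cols aP da.
have [c cs cx] := idx0_surj xP.
have [b bc] : exists b, incl l b = c.
  by apply: incl_surj; apply: supported_sub cs; exact: small_covered.
exists b; first by apply: g'P; rewrite bc cx.
exists 0, z; split; first exact: (submodule0 (supported_submodule _)).
by rewrite linear0 subr0 bc cx.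
Qed.

Let Rel_right (C C' : lmodType rat) (g : {linear chains M l -> C})
    (g' : {linear chains S l -> C'}) :
  (forall a, dh R F 0 (emb l a) = 0 -> g a = 0) ->
  (forall b, g' b = 0 -> dv R F l (idx0 l (incl l b)) = 0) ->
  forall b, g' b = 0 -> exists2 a, g a = 0 & Rel a b.
Proof.
move=> gP g'P b /g'P db.
have [w wc ws] := small_cycle hopen (@incl_covered l b) db.
set x := idx0 l (incl l b - sing_boundary R T l w).
have xP : isc 0 l.+1 x by exact: idx0_supported.
have dx : dv R F l x = 0.
  by rewrite /x !linearB db dv_idx0_boundary subr0.
have [y [z [zzx yP dy]]] := zigzag_exists dc (rows l) xP dx.
have [a ay] : exists a, emb l a = y := push_surj (@is_cell_embed R T F l) yP.
exists a; first by apply: gP; rewrite ay.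
by exists w, z; rewrite ay.
Qed.

Let Rel_boundary a b : Rel a b ->
  (exists a', boundary M l a' = a) <-> (exists b', boundary S l b' = b).
Proof.
move=> [w [z [wc zzx]]]; split=> [[a' a'E]|[b' b'E]].
  have a'P : isc l.+2 0 (emb l.+1 a') by apply: push_supported; exact: embed_is_cell.
  have dha' : dh R F 0 (emb l.+1 a') = emb l a by rewrite dh_embed a'E.
  have [v vP dvv] := zigzag_boundary_bottom dc cols' zzx a'P dha'.
  have [c cs cv] := idx0_surj vP.
  (* The boundary of [c] is [b] minus the boundary of [w], so [c + w] has boundary [b]. *)
  have [b' b'E] : exists b', incl l.+1 b' = c + w.
    apply: incl_surj; apply: (submoduleD (supported_submodule _)) => //.
    by apply: supported_sub cs; exact: small_covered.
  exists b'; apply: (@incl_inj l); rewrite -include_boundary b'E linearD.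
  apply/eqP; rewrite eq_sym -subr_eq; apply/eqP; apply: (@idx0_inj l).
  by rewrite -dvv -cv dv_index_chain.
set x := idx0 l _ in zzx.
have xP : isc 0 l.+1 x.
  by case: zzx => zP <- _ _; apply: dh_supported; exact: zP.
(* The boundary of [c] is the small chain at the start of the zigzag. Subtracting a boundary from
   [c] makes [c] small as well without changing its own boundary. *)
pose c := incl l.+1 b' - w.
have dcE : sing_boundary R T l c = incl l b - sing_boundary R T l w.
  by rewrite /c linearB include_boundary b'E.
have cc : supported (covered family (k := l.+1)) c.
  by apply: (submoduleB (supported_submodule _)) => //; exact: incl_covered.
have ds : supported (small family (k := l)) (sing_boundary R T l c).
  by rewrite dcE; have [c' c's /idx0_inj <-] := idx0_surj xP.
have [b1 _ b1s] := small_chains hopen cc ds.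
have vP := idx0_supported b1s.
have dvv : dv R F l.+1 (idx0 l.+1 (c - sing_boundary R T l.+1 b1)) = x.
  by rewrite dv_index_chain linearB sing_boundary_boundary subr0 dcE.
have [v' v'P dv'] := zigzag_boundary dc (rows l.+1) zzx vP dvv.
have [a' a'E] : exists a', emb l.+1 a' = v' := push_surj (@is_cell_embed R T F l.+1) v'P.
by exists a'; apply: (@emb_inj l); rewrite -dh_embed a'E.
Qed.

(** The outgoing maps enter through their kernels only. Leaving them abstract covers both the
    augmentation in degree 0 and the differential in higher degrees. *)
Lemma reduced_homology_isomorphic (C C' : lmodType rat) (g : {linear chains M l -> C})
    (g' : {linear chains S l -> C'}) :
  (forall a, g a = 0 <-> dh R F 0 (emb l a) = 0) ->
  (forall b, g' b = 0 <-> dv R F l (idx0 l (incl l b)) = 0) ->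
  lmod_isomorphic (homology (boundary M l) g) (homology (boundary S l) g').
Proof.
move=> gP g'P; apply: (@homology_isomorphic_of_relation _ _ _ _ _ _ _ g _ g' Rel).
- exact: Rel_linear.
- by apply: Rel_left => [a /gP|b /g'P].
- by apply: Rel_right => [a /gP|b /g'P].
- exact: Rel_boundary.
Qed.

End Comparison.

Theorem theorem3 (R : realType) (T : topologicalType) (F : {fset set T})
    (s : int)
    (hT : locally_path_connected R T)
    (hopen : forall U : set T, U \in F -> open U)
    (hacyclic : acyclic_with_slack R F s)
    (l : nat) (hl : s <= l%:Z) :
  lmod_isomorphic (reduced_multinerve_homology F l)
                  (reduced_singular_homology R (family_union F) l).
Proof.
(* In degree 0 both kernels are those of an augmentation, multiplied by the nonzero generator of the
   corner; in higher degrees the embeddings of chains are injective and commute with the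
   differentials. *)
case: l hl => [|l] hl; apply: (reduced_homology_isomorphic hT hopen hacyclic hl).
- move=> a; rewrite dh_embed0; split=> [->|/eqP]; first by rewrite scale0r.
  by rewrite scaler_eq0 => /orP[/eqP//|]; rewrite freegU_eq0.
- move=> b; rewrite dv_idx0_incl; split=> [->|/eqP]; first by rewrite scale0r.
  by rewrite scaler_eq0 => /orP[/eqP//|]; rewrite freegU_eq0.
- move=> a; rewrite dh_embed; split=> [->|h]; first by rewrite linear0.
  by apply: (@emb_inj R T F l); rewrite h linear0.
- move=> b; rewrite dv_index_chain include_boundary; split=> [->|h].
    by rewrite !linear0.
  by apply: (@incl_inj R T F l); apply: (@idx0_inj R T F l); rewrite h !linear0.
Qed.
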